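(* There is a closed linear subspace $E\subset L_1[0,1]$ that is isomorphic to $\ell_1$ (and hence has the Radon-Nikodým property) such that the quotient space $L_1[0,1]/E$ fails the Daugavet property.
   Context: All Banach spaces are real; $L_1[0,1]$ is taken with respect to Lebesgue measure. A Banach space $X$ has the Daugavet property if $\|\mathrm{Id}+T\|=1+\|T\|$ for every rank-one bounded linear operator $T\colon X\to X$. ''Isomorphic'' means linearly homeomorphic. *)

(* Defs.v *)
From HB Require Import structures.
From mathcomp Require Import all_boot all_order all_algebra.
From mathcomp Require Import all_classical all_reals all_analysis.
From mathcomp Require Import measurable_realfun.

Set Implicit Arguments.
Unset Strict Implicit.
Unset Printing Implicit Defensive.
Import Order.TTheory GRing.Theory Num.Theory.
Import numFieldNormedType.Exports.

Local Open Scope classical_set_scope.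
Local Open Scope ring_scope.

(** The library's [LspaceType1 mu] consists of classes of measurable functions
    modulo [mu]-a.e. equality with finite 1-norm, but it carries no algebraic
    or normed structure. This section makes it a [normedModType R]; the
    operations are those of representatives. *)
Section Lspace1_normed.
Context d (T : measurableType d) (R : realType).
Variable mu : {measure set T -> \bar R}.
Local Notation L := (LspaceType1 mu).
Local Notation Q := {mfun_ mu, T >-> measurableTypeR R}.
Local Open Scope quotient_scope.

HB.instance Definition _ := gen_eqMixin L.
HB.instance Definition _ := gen_choiceMixin L.

Let aeEqMfun_measurable (f : Q) : measurable_fun setT (f : T -> R).
Proof. by move=> mD B mB; exact: (measurable_funPT (repr f)). Qed.

Definition Lspace1_fun (f : L) : T -> R := f.

Lemma Lspace1_integrable (f : L) :
  mu.-integrable setT (EFin \o Lspace1_fun f).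
Proof.
apply/integrableP; split.
  by apply/measurable_EFinP; exact: aeEqMfun_measurable.
have := @Lebesgue_finite _ _ _ _ _ _ f.
by rewrite /finite_norm Lnorm1.
Qed.

Section class.
Variables (f : T -> R) (mf : mu.-integrable setT (EFin \o f)).

Let mf' : measurable_fun setT f.
Proof. by apply/measurable_EFinP; exact: measurable_int mf. Qed.
Let fm : {mfun T >-> measurableTypeR R} :=
  HB.pack f (@isMeasurableFun.Build _ _ T (measurableTypeR R) f mf').
Let cl : Q := \pi_Q fm.

Let clE : ae_eq mu setT (cl : T -> R) f.
Proof.
have /eqP := reprK cl; rewrite eqmodE => /asboolP; exact.
Qed.

Let cl_finite : finite_norm mu 1 (cl : T -> R).
Proof.
rewrite /finite_norm Lnorm1.
have -> : (\int[mu]_x `|(EFin \o (cl : T -> R)) x| =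
    \int[mu]_x `|(EFin \o f) x|)%E.
  apply: ae_eq_integral => //.
  - apply: measurableT_comp => //; apply/measurable_EFinP.
    exact: aeEqMfun_measurable.
  - by apply: measurableT_comp => //; exact/measurable_EFinP.
  - by move: clE; apply: filterS => x + xT => /= ->.
by case/integrableP: mf.
Qed.

Definition Lspace1_class : L :=
  LebesgueSpace.Pack (LebesgueSpace.Class (isFinLebesgue.Build _ _ _ mu 1%E (@lexx _ _ 1%E) cl cl_finite)).

Lemma Lspace1_classE : ae_eq mu setT (Lspace1_fun Lspace1_class) f.
Proof. exact: clE. Qed.
End class.

Lemma Lspace1_ext (f g : L) :
  ae_eq mu setT (Lspace1_fun f) (Lspace1_fun g) -> f = g.
Proof.
move: f g => [f [[ff]]] [g [[fg]]] fgE.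
have E : f = g.
  rewrite -[f]reprK -[g]reprK; apply/eqP; rewrite eqmodE; apply/asboolP.
  exact: fgE.
by move: ff fg fgE; rewrite E => ff fg _; rewrite (Prop_irrelevance ff fg).
Qed.


Definition Lspace1_zero : L := Lspace1_class (integrable0 mu setT).

Lemma Lspace1_addP (f g : L) :
  mu.-integrable setT (EFin \o (fun x => Lspace1_fun f x + Lspace1_fun g x)).
Proof. exact: integrableD (Lspace1_integrable f) (Lspace1_integrable g). Qed.
Definition Lspace1_add (f g : L) : L := Lspace1_class (Lspace1_addP f g).

Lemma Lspace1_oppP (f : L) :
  mu.-integrable setT (EFin \o (fun x => - Lspace1_fun f x)).
Proof. exact: integrableN (Lspace1_integrable f). Qed.
Definition Lspace1_opp (f : L) : L := Lspace1_class (Lspace1_oppP f).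

Lemma Lspace1_scaleP (a : R) (f : L) :
  mu.-integrable setT (EFin \o (fun x => a * Lspace1_fun f x)).
Proof. exact: integrableZl (Lspace1_integrable f). Qed.
Definition Lspace1_scale (a : R) (f : L) : L :=
  Lspace1_class (Lspace1_scaleP a f).

Lemma Lspace1_addE f g :
  {ae mu, forall x, Lspace1_fun (Lspace1_add f g) x
    = Lspace1_fun f x + Lspace1_fun g x}.
Proof. by move: (Lspace1_classE (Lspace1_addP f g)); apply: filterS => x; exact. Qed.
Lemma Lspace1_oppE f :
  {ae mu, forall x, Lspace1_fun (Lspace1_opp f) x = - Lspace1_fun f x}.
Proof. by move: (Lspace1_classE (Lspace1_oppP f)); apply: filterS => x; exact. Qed.
Lemma Lspace1_scaleE a f :
  {ae mu, forall x, Lspace1_fun (Lspace1_scale a f) x = a * Lspace1_fun f x}.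
Proof. by move: (Lspace1_classE (Lspace1_scaleP a f)); apply: filterS => x; exact. Qed.
Lemma Lspace1_zeroE : {ae mu, forall x, Lspace1_fun Lspace1_zero x = 0}.
Proof.
by move: (Lspace1_classE (integrable0 mu setT)); apply: filterS => x; exact.
Qed.

Let addA : associative Lspace1_add.
Proof.
move=> f g h; apply: Lspace1_ext.
apply: filterS3 (Lspace1_addE f (Lspace1_add g h)) (Lspace1_addE g h)
  (filterI (Lspace1_addE (Lspace1_add f g) h) (Lspace1_addE f g)) => x e1 e2 [e3 e4] _.
by rewrite e1 e2 e3 e4 addrA.
Qed.

Let addC : commutative Lspace1_add.
Proof.
move=> f g; apply: Lspace1_ext; apply: filterS2 (Lspace1_addE f g) (Lspace1_addE g f) => x -> -> _.
exact: addrC.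
Qed.

Let add0 : left_id Lspace1_zero Lspace1_add.
Proof.
move=> f; apply: Lspace1_ext.
by apply: filterS2 (Lspace1_addE Lspace1_zero f) Lspace1_zeroE => x -> -> _; rewrite add0r.
Qed.

Let addN : left_inverse Lspace1_zero Lspace1_opp Lspace1_add.
Proof.
move=> f; apply: Lspace1_ext.
apply: filterS3 (Lspace1_addE (Lspace1_opp f) f) (Lspace1_oppE f) Lspace1_zeroE => x -> -> -> _.
by rewrite addNr.
Qed.

HB.instance Definition _ := GRing.isZmodule.Build L addA addC add0 addN.

Let scaleA (a b : R) (f : L) :
  Lspace1_scale a (Lspace1_scale b f) = Lspace1_scale (a * b) f.
Proof.
apply: Lspace1_ext; apply: filterS3 (Lspace1_scaleE a (Lspace1_scale b f)) (Lspace1_scaleE b f)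
  (Lspace1_scaleE (a * b) f) => x -> -> -> _.
exact: mulrA.
Qed.

Let scale1 : left_id 1 Lspace1_scale.
Proof.
by move=> f; apply: Lspace1_ext; apply: filterS (Lspace1_scaleE 1 f) => x -> _; rewrite mul1r.
Qed.

Let scaleDr : right_distributive Lspace1_scale +%R.
Proof.
move=> a f g; apply: Lspace1_ext.
apply: filterS3 (filterI (Lspace1_scaleE a (f + g)) (Lspace1_addE f g)) (filterI (Lspace1_scaleE a f)
  (Lspace1_scaleE a g)) (Lspace1_addE (Lspace1_scale a f) (Lspace1_scale a g))
  => x [e1 e2] [e3 e4] e5 _.
by rewrite e1 e2 e5 e3 e4 mulrDr.
Qed.

Let scaleDl (f : L) : {morph Lspace1_scale^~ f : a b / a + b}.
Proof.
move=> a b; apply: Lspace1_ext.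
apply: filterS2 (filterI (Lspace1_scaleE (a + b) f) (Lspace1_addE (Lspace1_scale a f)
  (Lspace1_scale b f))) (filterI (Lspace1_scaleE a f) (Lspace1_scaleE b f)) => x [e1 e2] [e3 e4] _.
by rewrite e1 e2 e3 e4 mulrDl.
Qed.

HB.instance Definition _ :=
  GRing.Zmodule_isLmodule.Build R L scaleA scale1 scaleDr scaleDl.

Lemma Lspace1_measurable (f : L) : measurable_fun setT (Lspace1_fun f).
Proof. exact: aeEqMfun_measurable. Qed.

Definition Lspace1_norm (f : L) : R := fine ('N[mu]_1[EFin \o Lspace1_fun f]).

Lemma Lspace1_normE f : ((Lspace1_norm f)%:E = \int[mu]_x `|(Lspace1_fun f x)%:E|)%E.
Proof.
rewrite /Lspace1_norm Lnorm1 fineK// ge0_fin_numE ?integral_ge0//.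
by case/integrableP: (Lspace1_integrable f).
Qed.

Let ae_norm (f : L) (g : T -> R) : measurable_fun setT g ->
    {ae mu, forall x, Lspace1_fun f x = g x} ->
  ((Lspace1_norm f)%:E = \int[mu]_x `|(g x)%:E|)%E.
Proof.
move=> mg fg; rewrite Lspace1_normE; apply: ae_eq_integral => //.
- apply: measurableT_comp => //; apply/measurable_EFinP.
  exact: aeEqMfun_measurable.
- by apply: measurableT_comp => //; exact/measurable_EFinP.
- by apply: filterS fg => x -> _.
Qed.

Let norm_triangle (f g : L) :
  Lspace1_norm (f + g) <= Lspace1_norm f + Lspace1_norm g.
Proof.
rewrite -lee_fin EFinD (ae_norm _ (Lspace1_addE f g)); last by
  apply: measurable_funD; exact: Lspace1_measurable.
rewrite !Lspace1_normE -ge0_integralD//; last 2 first.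
- by apply: measurableT_comp => //; apply/measurable_EFinP; exact: Lspace1_measurable.
- by apply: measurableT_comp => //; apply/measurable_EFinP; exact: Lspace1_measurable.
apply: ge0_le_integral => //.
- apply: measurableT_comp => //; apply/measurable_EFinP.
  by apply: measurable_funD; exact: Lspace1_measurable.
- by apply: emeasurable_funD; apply: measurableT_comp => //;
    apply/measurable_EFinP; exact: Lspace1_measurable.
- by move=> x _; rewrite -EFinD lee_fin ler_normD.
Qed.

Let normZ (a : R) (f : L) : Lspace1_norm (a *: f) = `|a| * Lspace1_norm f.
Proof.
apply: EFin_inj; rewrite EFinM (ae_norm _ (Lspace1_scaleE a f)); last first.
  by apply: measurable_funM => //; exact: Lspace1_measurable.
rewrite Lspace1_normE -ge0_integralZl//.
  by apply: eq_integral => x _; rewrite -EFinM/= normrM.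
by apply: measurableT_comp => //; apply/measurable_EFinP; exact: Lspace1_measurable.
Qed.

Let norm_eq0 (f : L) : Lspace1_norm f = 0 -> f = 0.
Proof.
move=> f0; apply: Lspace1_ext.
have : (\int[mu]_(x in setT) `|(EFin \o Lspace1_fun f) x| = 0)%E.
  by rewrite -Lspace1_normE f0.
move/(ae_eq_integral_abs _ measurableT) => h.
have {}h : ae_eq mu setT (EFin \o Lspace1_fun f) (cst 0%E).
  by apply: h; apply/measurable_EFinP; exact: aeEqMfun_measurable.
by apply: filterS2 h Lspace1_zeroE => x + -> _ => /(_ I) [->].
Qed.

HB.instance Definition _ :=
  Lmodule_isNormed.Build R L norm_triangle normZ norm_eq0.
End Lspace1_normed.

(** The measure lives on the whole line but is carried by [0, 1], so that values
    outside [0, 1] are irrelevant up to a.e. equality. *)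
Definition L1_unit_interval (R : realType) : normedModType R :=
  LspaceType1 (mrestr (@lebesgue_measure R) (@measurable_itv R `[0, 1])).

(** Null sets for the counting measure are empty: the elements are sequences,
    and the norm is the sum of the absolute values. *)
Definition ell1 (R : realType) : normedModType R :=
  LspaceType1 (@counting nat R).

Record closed_subspace (R : realType) (V : normedModType R) := ClosedSubspace {
  subspace_set :> set V;
  subspace_submod : submod_closed (mem subspace_set);
  subspace_closed : closed subspace_set }.

Section closed_subspace.
Variables (R : realType) (V : normedModType R) (E : closed_subspace V).

Definition subspace_pred : {pred V} := mem (subspace_set E).

HB.instance Definition _ :=
  GRing.isSubmodClosed.Build R V subspace_pred (subspace_submod E).

Let subspace_oppr : oppr_closed subspace_pred.
Proof. by move=> x xE; rewrite -scaleN1r; exact: rpredZ. Qed.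

HB.instance Definition _ :=
  GRing.isOppClosed.Build V subspace_pred subspace_oppr.

(** [E] as a normed space of its own, with the norm of [V]. *)
Record subspace_type := SubspaceElt {
  subspace_val :> V;
  subspace_valP : subspace_val \in subspace_pred }.

HB.instance Definition _ := [isSub for subspace_val].
HB.instance Definition _ := [Choice of subspace_type by <:].
HB.instance Definition _ := [SubChoice_isSubLmodule of subspace_type by <:].

Let norm_triangle (x y : subspace_type) : `|\val (x + y)| <= `|\val x| + `|\val y|.
Proof. by rewrite raddfD; exact: ler_normD. Qed.

Let normZ (a : R) (x : subspace_type) : `|\val (a *: x)| = `|a| * `|\val x|.
Proof. by rewrite linearZ; exact: normrZ. Qed.

Let norm_eq0 (x : subspace_type) : `|\val x| = 0 -> x = 0.
Proof. by move=> /normr0_eq0 x0; apply: val_inj; rewrite x0 raddf0. Qed.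

HB.instance Definition _ :=
  Lmodule_isNormed.Build R subspace_type norm_triangle normZ norm_eq0.

Local Open Scope quotient_scope.

(** The quotient [V / E], with the norm
    [|q| = inf {|x| | x is a representative of q}]. *)
Definition quotient_space : Type := {ideal_quot subspace_pred}.

HB.instance Definition _ := GRing.Zmodule.on quotient_space.

Definition quotient_proj (x : V) : quotient_space := \pi_({ideal_quot subspace_pred}) x.


Lemma quotient_projP (x y : V) :
  quotient_proj x = quotient_proj y <-> x - y \in subspace_pred.
Proof. by rewrite Quotient.idealrBE; split=> /eqP. Qed.

Lemma quotient_projD (x y : V) :
  quotient_proj (x + y) = quotient_proj x + quotient_proj y.
Proof. exact: pi_addr. Qed.

Lemma quotient_proj_surj (q : quotient_space) : exists x, quotient_proj x = q.
Proof. by exists (repr (q : {ideal_quot subspace_pred})); exact: reprK. Qed.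

Definition quotient_scale (a : R) (q : quotient_space) : quotient_space :=
  quotient_proj (a *: repr (q : {ideal_quot subspace_pred})).

Let quotient_scaleE (a : R) (x : V) :
  quotient_scale a (quotient_proj x) = quotient_proj (a *: x).
Proof.
apply/quotient_projP; rewrite -scalerBr rpredZ//; apply/quotient_projP.
exact: reprK.
Qed.

Let scaleA (a b : R) (q : quotient_space) :
  quotient_scale a (quotient_scale b q) = quotient_scale (a * b) q.
Proof.
by have [x <-] := quotient_proj_surj q; rewrite !quotient_scaleE scalerA.
Qed.

Let scale1 : left_id 1 quotient_scale.
Proof.
by move=> q; have [x <-] := quotient_proj_surj q; rewrite quotient_scaleE scale1r.
Qed.

Let scaleDr : right_distributive quotient_scale +%R.
Proof.
move=> a p q; have [x <-] := quotient_proj_surj p.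
have [y <-] := quotient_proj_surj q.
by rewrite -quotient_projD !quotient_scaleE -quotient_projD scalerDr.
Qed.

Let scaleDl (q : quotient_space) : {morph quotient_scale^~ q : a b / a + b}.
Proof.
move=> a b; have [x <-] := quotient_proj_surj q.
by rewrite !quotient_scaleE -quotient_projD scalerDl.
Qed.

HB.instance Definition _ := GRing.Zmodule_isLmodule.Build R quotient_space
  scaleA scale1 scaleDr scaleDl.

Lemma quotient_projZ (a : R) (x : V) :
  quotient_proj (a *: x) = a *: quotient_proj x.
Proof. exact/esym/quotient_scaleE. Qed.

Lemma quotient_proj_eq0 (x : V) : quotient_proj x = 0 <-> (E : set V) x.
Proof.
have <- : quotient_proj 0 = 0 by exact: pi_zeror.
by rewrite quotient_projP subr0 in_setE.
Qed.

Definition quotient_norm (q : quotient_space) : R :=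
  inf [set `|x| | x in [set x | quotient_proj x = q]].

Let quotient_norm_has_inf (q : quotient_space) :
  has_inf [set `|x| | x in [set x | quotient_proj x = q]].
Proof.
split; last by exists 0 => _ [x _ <-].
by have [x <-] := quotient_proj_surj q; exists `|x|, x.
Qed.

Let quotient_norm_le (x : V) : quotient_norm (quotient_proj x) <= `|x|.
Proof. by apply: ge_inf; [have [] := quotient_norm_has_inf (quotient_proj x)|exists x]. Qed.

Let quotient_norm_adherent (q : quotient_space) (e : R) : 0 < e ->
  exists2 x, quotient_proj x = q & `|x| < quotient_norm q + e.
Proof.
move=> /(inf_adherent) /(_ (quotient_norm_has_inf q)) [_ [x xq <-] xlt].
by exists x.
Qed.

Let quotient_norm_triangle (p q : quotient_space) :
  quotient_norm (p + q) <= quotient_norm p + quotient_norm q.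
Proof.
apply/ler_addgt0Pr => e e0; have e20 : 0 < e / 2 by rewrite divr_gt0.
have [x <- xp] := quotient_norm_adherent p e20.
have [y <- yq] := quotient_norm_adherent q e20.
rewrite -quotient_projD (le_trans (quotient_norm_le _))//.
rewrite (le_trans (ler_normD _ _))// [e]splitr addrACA.
by rewrite lerD// ltW.
Qed.

Let quotient_norm_ge0 (q : quotient_space) : 0 <= quotient_norm q.
Proof. by apply: lb_le_inf; [have [] := quotient_norm_has_inf q|move=> _ [x _ <-]]. Qed.

Let quotient_normZ_le (a : R) (q : quotient_space) :
  quotient_norm (a *: q) <= `|a| * quotient_norm q.
Proof.
apply/ler_addgt0Pr => e e0.
have d0 : 0 < e / (`|a| + 1) by rewrite divr_gt0// ltr_wpDl.
have [x <- xq] := quotient_norm_adherent q d0.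
rewrite -quotient_projZ (le_trans (quotient_norm_le _))// normrZ.
rewrite (le_trans (ler_wpM2l _ (ltW xq)))// mulrDr lerD2l mulrCA ger_pMr//.
by rewrite ler_pdivrMr ?mul1r ?lerDl// ltr_wpDl.
Qed.

Let quotient_normZ (a : R) (q : quotient_space) :
  quotient_norm (a *: q) = `|a| * quotient_norm q.
Proof.
apply/eqP; rewrite eq_le quotient_normZ_le/=.
have [->|a0] := eqVneq a 0; first by rewrite normr0 mul0r quotient_norm_ge0.
rewrite -ler_pdivlMl ?normr_gt0// -normfV.
by have := quotient_normZ_le a^-1 (a *: q); rewrite scalerA mulVf// scale1r.
Qed.

Let quotient_norm_eq0 (q : quotient_space) : quotient_norm q = 0 -> q = 0.
Proof.
have [x <-] := quotient_proj_surj q => x0; apply/quotient_proj_eq0.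
apply: subspace_closed => B /nbhs_ballP[e /= e0 eB].
have [y yx] := quotient_norm_adherent (quotient_proj x) e0.
rewrite x0 add0r => ye; exists (x - y); split.
  by rewrite -in_setE; apply/quotient_projP.
by apply: eB; rewrite -ball_normE/= opprB addrC subrK.
Qed.

HB.instance Definition _ := Lmodule_isNormed.Build R quotient_space
  quotient_norm_triangle quotient_normZ quotient_norm_eq0.
End closed_subspace.

Definition operator_norm (R : realType) (X Y : normedModType R) (f : X -> Y) : R :=
  sup [set `|f x| | x in [set x | `|x| <= 1]].

Definition rank_one (R : realType) (X Y : normedModType R) (f : X -> Y) :=
  exists2 y : Y, y != 0 & range f = [set a *: y | a in [set: R]].

Definition daugavet_property (R : realType) (X : normedModType R) :=
  forall T : {linear X -> X}, continuous T -> rank_one T ->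
    operator_norm (fun x => x + T x) = 1 + operator_norm T.

Definition isomorphic (R : realType) (X Y : normedModType R) :=
  exists (f : {linear X -> Y}) (g : {linear Y -> X}),
    [/\ cancel f g, cancel g f, continuous f & continuous g].

(** The Radon-Nikodym property, in the sense of Diestel and Uhl (Vector Measures,
    1977): every countably additive vector measure of bounded variation which is
    absolutely continuous with respect to a finite measure has a Bochner
    integrable density. *)
Section radon_nikodym_property.
Context d (T : measurableType d) (R : realType) (X : normedModType R).
Variable mu : {finite_measure set T -> \bar R}.

Definition vector_measure (G : set T -> X) :=
  forall A : (set T)^nat, (forall n, measurable (A n)) -> trivIset setT A ->
    series (G \o A) @ \oo --> G (\bigcup_n A n).

(** Finite disjoint families bound the same sums as finite partitions; only the
    first [n] sets of the sequence matter. *)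
Definition finite_variation (G : set T -> X) :=
  exists M : R, forall (n : nat) (A : (set T)^nat),
    (forall i, measurable (A i)) -> trivIset setT A ->
    \sum_(i < n) `|G (A i)| <= M.

(** For a countably additive [G] and a finite [mu], equivalent to
    [G A] tending to 0 as [mu A] tends to 0. *)
Definition vanishes_on_null_sets (G : set T -> X) :=
  forall A, measurable A -> mu A = 0%E -> G A = 0.

Definition simple_function (s : T -> X) :=
  finite_set (range s) /\ forall x, measurable (s @^-1` [set x]).

Definition simple_integral (A : set T) (s : T -> X) : X :=
  \sum_(x \in range s) fine (mu (A `&` s @^-1` [set x])) *: x.

Definition bochner_approximation (g : T -> X) (s : (T -> X)^nat) :=
  [/\ forall n, simple_function (s n),
      {ae mu, forall w, s n w @[n --> \oo] --> g w} &
      (\int[mu]_w `|g w - s n w|%:E)%E @[n --> \oo] --> 0%E].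

Definition has_bochner_integral (A : set T) (g : T -> X) (v : X) :=
  exists2 s, bochner_approximation g s &
    simple_integral A (s n) @[n --> \oo] --> v.

End radon_nikodym_property.

Definition radon_nikodym_property (R : realType) (X : normedModType R) :=
  forall (d : measure_display) (T : measurableType d)
    (mu : {finite_measure set T -> \bar R})
    (G : set T -> X),
    vector_measure G -> finite_variation G -> vanishes_on_null_sets mu G ->
    exists g : T -> X,
      forall A, measurable A -> has_bochner_integral mu A g (G A).

(* Main.v *)
Require Import Defs.
From HB Require Import structures.
From mathcomp Require Import finmap all_boot all_order all_algebra.
From mathcomp Require Import all_classical all_reals all_analysis.
From mathcomp Require Import measurable_realfun lra.

(** Split [0, 1] into a set [A] of positive measure and disjoint cells [B n] of
    positive measure. For [v] in L1 write [cut v] for the restriction of [v] to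
    [A], [mass v] for its integral over [A], and let [a] and [b n] be the
    normalized indicators of [A] and [B n]. Let [(h n)] be a dense sequence
    in L1, and let [E] be the closed span of the vectors
      [e n = b n + (cut (h n) - mass (h n) *: a) / |cut (h n)|].

    The [e n] are bounded, and integration over the disjoint cells recovers the
    coefficients of a combination of the [e n] with a bound by its norm. Hence
    [E] is isomorphic to l1, and it is even the range of a bounded projection,
    which makes it closed ([complemented_range_subspace]).

    The functional [mass] vanishes on [E], so [q |-> - mass q *: [a]] is a rank
    one operator [T] on the quotient by [E]. Modulo [E], the vector
    [cut (h n) - mass (h n) *: a] equals [- |cut (h n)| *: b n], whose L1 norm
    is [|cut (h n)|]; by density [cut v - mass v *: a] has quotient norm at most
    [|cut v|] for every [v]. Adding the part of [v] outside [A], the class of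
    [v - mass v *: a] has norm at most [|v|] ([deflation_le]): thus
    [|Id + T| <= 1 < 1 + |T|], and the quotient fails the Daugavet property
    ([deflation_not_daugavet]). The functions [h n] here are the rational step
    functions on uniform grids ([rat_step_dense]).

    The Radon-Nikodym property is invariant under isomorphism
    ([radon_nikodym_isomorphic]), and for l1 it reduces to scalar densities
    [g i] of the coordinates of the vector measure: testing the variation on the
    partition of the space by the signs of [g 0], ..., [g (N - 1)] bounds the
    sum of the integrals of the [|g i|] by the variation
    ([partial_variation_le]), so that [(g i x)_i] is almost surely in l1 and is
    the required density ([ell1_bochner_density]). *)

Set Implicit Arguments.
Unset Strict Implicit.
Unset Printing Implicit Defensive.
Import Order.TTheory GRing.Theory Num.Theory.
Import numFieldNormedType.Exports.

Local Open Scope classical_set_scope.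
Local Open Scope ring_scope.

(** * The space l1 as sequences *)

(** Fubini's theorem, with l1 on one side, takes the counting measure as a bundled
    sigma-finite measure. *)
HB.instance Definition _ (R : realType) :=
  Measure_isSigmaFinite.Build _ _ _ (@counting nat R) (sigma_finite_counting R).

Section ell1_facts.
Variable R : realType.
Local Notation counting := (@counting nat R).

Lemma counting_set1 n : counting [set n] = 1%E.
Proof.
rewrite /counting/= asboolT; last exact: finite_set1.
by rewrite fset_set1 finmap.cardfs1.
Qed.

(** Singletons have mass 1, so that only the empty set is negligible. *)
Lemma ae_countingP (P : nat -> Prop) : {ae counting, forall n, P n} -> forall n, P n.
Proof.
move=> [N [mN N0 PN]] n; apply: contrapT => nP.
have : (counting [set n] <= counting N)%E.
  by apply: le_measure; rewrite ?inE// => _ ->; exact: PN.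
by rewrite N0 counting_set1 lee_fin ler10.
Qed.

Lemma Rintegral_counting1 (g : nat -> R) n : (forall m, m != n -> g m = 0) ->
  \int[counting]_m g m = g n.
Proof.
move=> g0; rewrite -[g in LHS](_ : (cst (g n)) \_ [set n] = g).
  rewrite -Rintegral_mkcond Rintegral_cst// -[RHS]mulr1; congr (_ * _).
  exact: (congr1 fine (counting_set1 n)).
apply/funext => m; rewrite patchE; case: ifPn; first by rewrite inE => ->.
by move=> mn; rewrite g0//; apply: contra mn => /eqP ->; rewrite inE.
Qed.

Lemma ell1_addE (u v : ell1 R) n :
  Lspace1_fun (u + v) n = Lspace1_fun u n + Lspace1_fun v n.
Proof. by move: n; apply: ae_countingP; exact: Lspace1_addE. Qed.

Lemma ell1_scaleE k (u : ell1 R) n : Lspace1_fun (k *: u) n = k * Lspace1_fun u n.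
Proof. by move: n; apply: ae_countingP; exact: Lspace1_scaleE. Qed.

Lemma ell1_ext (u v : ell1 R) : Lspace1_fun u =1 Lspace1_fun v -> u = v.
Proof. by move=> uv; apply: Lspace1_ext; apply: aeW => n _. Qed.

Lemma ell1_norm (u : ell1 R) : (`|u|%:E = \sum_(n <oo) `|Lspace1_fun u n|%:E)%E.
Proof. by rewrite -ge0_integral_count//; exact: Lspace1_normE. Qed.

Lemma ell1_partial_sum_le (u : ell1 R) N : \sum_(i < N) `|Lspace1_fun u i| <= `|u|.
Proof.
rewrite -lee_fin ell1_norm -sumEFin -(big_mkord xpredT (fun i => `|Lspace1_fun u i|%:E)).
by apply: nneseries_lim_ge => n _ _; rewrite lee_fin.
Qed.

Lemma ell1_coord_le (u : ell1 R) i : `|Lspace1_fun u i| <= `|u|.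
Proof.
by rewrite (le_trans _ (ell1_partial_sum_le u i.+1))// big_ord_recr/= lerDr sumr_ge0.
Qed.

Definition ell1_coord i (u : ell1 R) : R^o := Lspace1_fun u i.

Lemma ell1_coord_linear i : linear (ell1_coord i).
Proof. by move=> k u v; rewrite /ell1_coord ell1_addE ell1_scaleE. Qed.

HB.instance Definition _ i := GRing.isLinear.Build _ _ _ _ (ell1_coord i) (ell1_coord_linear i).

Lemma ell1_of_seqP (a : nat -> R) : (\sum_(n <oo) `|a n|%:E < +oo)%E ->
  counting.-integrable setT (EFin \o a).
Proof. by move=> a1; apply/integrableP; split=> //; rewrite ge0_integral_count. Qed.

Lemma ell1_classE (a : nat -> R) (ia : counting.-integrable setT (EFin \o a)) n :
  Lspace1_fun (Lspace1_class ia) n = a n.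
Proof.
move: n; apply: ae_countingP; move: (Lspace1_classE ia).
by apply: filterS => n; exact.
Qed.

End ell1_facts.

Section measurable_discrete_product.
Context d (T : measurableType d) (R : realType).

(** A preimage is the union over [n] of its sections at [n]. *)
Lemma measurable_fun_nat_prod (K : nat * T -> R) :
  (forall n, measurable_fun setT (fun x => K (n, x))) -> measurable_fun setT K.
Proof.
move=> mK _ Y mY; rewrite setTI.
have -> : K @^-1` Y = \bigcup_n ([set n] `*` ((fun x => K (n, x)) @^-1` Y)).
  apply/seteqP; split=> [[n x] /= KY|[n x] [m _ [/= -> //]]].
  by exists n.
apply: bigcup_measurable => n _; apply: measurableX => //.
by rewrite -[X in measurable X]setTI; exact: mK.
Qed.

Lemma measurable_fun_prod_nat (K : T * nat -> R) :
  (forall n, measurable_fun setT (fun x => K (x, n))) -> measurable_fun setT K.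
Proof.
move=> mK _ Y mY; rewrite setTI.
have -> : K @^-1` Y = \bigcup_n (((fun x => K (x, n)) @^-1` Y) `*` [set n]).
  apply/seteqP; split=> [[x n] /= KY|[x n] [m _ [//= + ->]]//].
  by exists n.
apply: bigcup_measurable => n _; apply: measurableX => //.
by rewrite -[X in measurable X]setTI; exact: mK.
Qed.

End measurable_discrete_product.

(** * Norms and integral operators between L1 spaces *)

Section Lspace1_facts.
Context d (T : measurableType d) (R : realType).
Variable mu : {measure set T -> \bar R}.

Lemma Lspace1_normE_ae (f : LspaceType1 mu) (g : T -> R) : measurable_fun setT g ->
    {ae mu, forall x, Lspace1_fun f x = g x} ->
  (`|f|%:E = \int[mu]_x `|g x|%:E)%E.
Proof.
move=> mg fg; transitivity (\int[mu]_x `|(Lspace1_fun f x)%:E|)%E.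
  exact: Lspace1_normE.
apply: ae_eq_integral => //.
- by apply: measurableT_comp => //; apply/measurable_EFinP; exact: Lspace1_measurable.
- by apply/measurable_EFinP; apply: measurableT_comp.
- by apply: filterS fg => x /= -> _.
Qed.

Lemma Lspace1_norm_class (f : T -> R) (mf : mu.-integrable setT (EFin \o f)) :
  (`|Lspace1_class mf|%:E = \int[mu]_x `|f x|%:E)%E.
Proof.
apply: Lspace1_normE_ae.
  by apply/measurable_EFinP; exact: measurable_int mf.
by apply: filterS (Lspace1_classE mf) => x /(_ I).
Qed.

End Lspace1_facts.

(** Integration against a kernel all of whose sections [K (s, _)] have norm at
    most [C] is a bounded operator between L1 spaces, by Fubini and Tonelli.
    With the counting measure on one side, this covers both the synthesis of a
    series from its coefficients and the extraction of coefficients. *)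
Section kernel_operator.
Context d1 d2 (T1 : measurableType d1) (T2 : measurableType d2) (R : realType).
Variables (m1 : {sigma_finite_measure set T1 -> \bar R}).
Variables (m2 : {sigma_finite_measure set T2 -> \bar R}).
Variables (K : T1 * T2 -> R) (C : R).
Hypothesis mK : measurable_fun setT K.
Hypothesis KC : forall s, (\int[m2]_t `|K (s, t)|%:E <= C%:E)%E.

Let section_measurable s : measurable_fun setT (fun t => K (s, t)).
Proof. by apply: measurableT_comp => //; exact: measurable_pair1. Qed.

Let F (f : LspaceType1 m1) (z : T1 * T2) : \bar R :=
  (Lspace1_fun f z.1 * K z)%:E.

Let mF f : measurable_fun setT (F f).
Proof.
apply/measurable_EFinP; apply: measurable_funM => //.
by apply: measurableT_comp => //; exact: Lspace1_measurable.
Qed.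

Let F_section_measurable f t : measurable_fun setT (fun s => F f (s, t)).
Proof. by apply: (measurableT_comp (mF f)); exact: measurable_pair2. Qed.

Let F_bound f : (\int[m1]_s \int[m2]_t `|F f (s, t)| <= (C * `|f|)%:E)%E.
Proof.
rewrite EFinM (@Lspace1_normE_ae _ _ _ _ f (Lspace1_fun f)); last 2 first.
- exact: Lspace1_measurable.
- exact: aeW.
have C0 : 0 <= C.
  by rewrite -lee_fin (le_trans _ (KC point))// integral_ge0.
rewrite -ge0_integralZl//; last first.
  by apply/measurable_EFinP; apply: measurableT_comp => //; exact: Lspace1_measurable.
apply: ge0_le_integral => //.
- by move=> s _; exact: integral_ge0.
- apply: (measurable_fun_fubini_tonelli_F (abse \o F f)) => //=.
  exact: measurableT_comp.
- by apply/measurable_EFinP; apply: measurable_funM => //;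
    apply: measurableT_comp => //; exact: Lspace1_measurable.
move=> s _; rewrite muleC.
rewrite (eq_integral (fun t => `|Lspace1_fun f s|%:E * `|K (s, t)|%:E)%E); last first.
  by move=> t _; rewrite /F/= normrM EFinM.
rewrite ge0_integralZl// ?lee_wpmul2l//.
by apply/measurable_EFinP; apply: measurableT_comp.
Qed.

Let F_integrable f : (m1 \x m2)%E.-integrable setT (F f).
Proof. by apply/integrable12ltyP => //; rewrite (le_lt_trans (F_bound f))// ltry. Qed.

Let image_measurable (f : LspaceType1 m1) :
  measurable_fun setT (fun t => \int[m1]_s (Lspace1_fun f s * K (s, t))).
Proof.
apply: measurableT_comp => //; exact: measurable_fubini_G (F_integrable f).
Qed.

Let image_le (f : LspaceType1 m1) t :
  (`|\int[m1]_s (Lspace1_fun f s * K (s, t))|%:E <= \int[m1]_s `|F f (s, t)|)%E.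
Proof.
apply: le_trans (le_abse_integral _ _ _) => //.
by rewrite /Rintegral /F/=; case: (integral _ _ _) => [r| |]//=; rewrite ?normr0 ?leey.
Qed.

Let image_bound (f : LspaceType1 m1) :
  (\int[m2]_t `|\int[m1]_s (Lspace1_fun f s * K (s, t))|%:E <= (C * `|f|)%:E)%E.
Proof.
rewrite (le_trans _ (F_bound f))//.
have -> : (\int[m1]_s \int[m2]_t `|F f (s, t)| = \int[m2]_t \int[m1]_s `|F f (s, t)|)%E.
  by apply: (fubini_tonelli (abse \o F f)) => //=; exact: measurableT_comp.
apply: ge0_le_integral => //.
- by apply/measurable_EFinP; apply: measurableT_comp.
- by apply: (measurable_fun_fubini_tonelli_G (abse \o F f)) => //=; exact: measurableT_comp.
Qed.

Let kernel_integrable (f : LspaceType1 m1) :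
  m2.-integrable setT (EFin \o (fun t => \int[m1]_s (Lspace1_fun f s * K (s, t)))).
Proof.
apply/integrableP; split; first exact/measurable_EFinP.
by rewrite (le_lt_trans (image_bound f))// ltry.
Qed.

Definition kernel_operator (f : LspaceType1 m1) : LspaceType1 m2 :=
  Lspace1_class (kernel_integrable f).

Lemma kernel_operatorE (f : LspaceType1 m1) : {ae m2, forall t, Lspace1_fun (kernel_operator f) t =
  \int[m1]_s (Lspace1_fun f s * K (s, t))}.
Proof. by move: (Lspace1_classE (kernel_integrable f)); apply: filterS => t; exact. Qed.

Lemma kernel_operator_linear : linear kernel_operator.
Proof.
move=> a f g; apply: Lspace1_ext.
apply: filterS3 (filterI (kernel_operatorE (a *: f + g)) (kernel_operatorE f))
  (filterI (kernel_operatorE g) (Lspace1_addE (a *: kernel_operator f) (kernel_operator g)))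
  (filterI (Lspace1_scaleE a (kernel_operator f))
     (filterI (ae_integrable2 (F_integrable f)) (ae_integrable2 (F_integrable g)))).
move=> t [-> fE] [gE ->] [-> [fi gi]] _; rewrite fE gE.
rewrite -RintegralZl// -RintegralD//; last exact: (integrableZl _ a fi).
rewrite /Rintegral; congr fine; apply: ae_eq_integral => //.
- exact: (F_section_measurable (a *: f + g) t).
- apply/measurable_EFinP; apply: measurable_funD.
    by apply: measurable_funM => //; apply/measurable_EFinP; exact: measurable_int fi.
  by apply/measurable_EFinP; exact: measurable_int gi.
apply: filterS2 (Lspace1_addE (a *: f) g) (Lspace1_scaleE a f) => s + + _.
by rewrite -/(a *: f + g) => -> ->; rewrite mulrDl mulrA.
Qed.

Lemma kernel_operator_bounded f : `|kernel_operator f| <= C * `|f|.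
Proof. by rewrite -lee_fin Lspace1_norm_class image_bound. Qed.
End kernel_operator.

(** * Quotients by a complemented subspace and rank one deflations *)

Section linear_bounds.
Variables (R : realType) (V W : normedModType R) (f : {linear V -> W}).

Lemma continuous_of_bound (C : R) : (forall x, `|f x| <= C * `|x|) -> continuous f.
Proof.
move=> fC; apply/linear_bounded_continuous/linear_boundedP; near=> r => x.
by rewrite (le_trans (fC x))// ler_wpM2r//; near: r; exact: nbhs_pinfty_ge.
Unshelve. all: by end_near. Qed.

Lemma bound_of_continuous : continuous f -> exists2 C : R, 0 < C & forall x, `|f x| <= C * `|x|.
Proof.
by move=> /linear_bounded_continuous/linear_boundedP/pinfty_ex_gt0[C C0 fC]; exists C.
Qed.
End linear_bounds.

Section quotient_norm_facts.
Variables (R : realType) (V : normedModType R) (E : closed_subspace V).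

Let has_inf_norms (q : quotient_space E) :
  has_inf [set `|x| | x in [set x | quotient_proj E x = q]].
Proof.
split; last by exists 0 => _ [x _ <-].
by have [x <-] := quotient_proj_surj q; exists `|x|, x.
Qed.

Lemma quotient_proj_norm_le (x : V) : `|quotient_proj E x| <= `|x|.
Proof.
by apply: ge_inf; [have [] := has_inf_norms (quotient_proj E x)|exists x].
Qed.

Lemma le_quotient_norm (q : quotient_space E) (M : R) :
  (forall x, quotient_proj E x = q -> M <= `|x|) -> M <= `|q|.
Proof.
by move=> h; apply: lb_le_inf; [have [] := has_inf_norms q|move=> _ [x /h ? <-]].
Qed.

Lemma quotient_proj_linear : linear (quotient_proj E).
Proof. by move=> k x y; rewrite quotient_projD quotient_projZ. Qed.

End quotient_norm_facts.

(** If [f a = 1] and subtracting [f v *: a] does not increase norms modulo [E],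
    then the identity minus the rank one projection [q |-> f q *: [a]] has norm
    at most 1, whereas the Daugavet equation asks for 1 plus the positive norm
    of that projection. *)
Section rank_one_deflation.
Variables (R : realType) (V : normedModType R) (E : closed_subspace V).
Variables (f : {linear V -> R^o}) (a : V).
Hypotheses (f_le : forall v, `|f v| <= `|v|).
Hypotheses (fE : forall v, (E : set V) v -> f v = 0).
Hypothesis fa : f a = 1.
Hypothesis deflation_le : forall v, `|quotient_proj E (v - f v *: a)| <= `|v|.

(* [f] does not depend on the representative, since it vanishes on [E]. *)
Let phi (q : quotient_space E) : R := f (xget 0 [set x | quotient_proj E x = q]).

Let phiE x : phi (quotient_proj E x) = f x.
Proof.
rewrite /phi; case: xgetP => [y _ /= /quotient_projP yx|/(_ x)/(_ erefl)//].
by apply/eqP; rewrite -subr_eq0 -linearB fE// -in_setE.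
Qed.

Let T (q : quotient_space E) : quotient_space E := - phi q *: quotient_proj E a.

Let T_linear : linear T.
Proof.
move=> k p q; have [x <-] := quotient_proj_surj p.
have [y <-] := quotient_proj_surj q.
rewrite -quotient_proj_linear /T !phiE linearP scalerA -scalerDl.
by congr (_ *: _); rewrite opprD mulrN.
Qed.

HB.instance Definition _ := GRing.isLinear.Build _ _ _ _ T T_linear.

Let phi_le q : `|phi q| <= `|q|.
Proof. by apply: le_quotient_norm => x <-; rewrite phiE. Qed.

Let proj_a_neq0 : quotient_proj E a != 0.
Proof.
apply/eqP => /quotient_proj_eq0/fE; rewrite fa => /eqP.
by rewrite oner_eq0.
Qed.

Let T_le q : `|T q| <= `|quotient_proj E a| * `|q|.
Proof. by rewrite normrZ normrN mulrC ler_wpM2l. Qed.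

Lemma deflation_not_daugavet : ~ daugavet_property (quotient_space E).
Proof.
move=> D; have Tcont : continuous T.
  exact: continuous_of_bound T_le.
have Trank : rank_one T.
  exists (quotient_proj E a) => //; apply/seteqP; split=> [_ [q _ <-]|_ [k _ <-]].
    by exists (- phi q).
  exists (quotient_proj E (- k *: a)) => //.
  by rewrite /T phiE linearZ/= fa /GRing.scale/= mulr1 opprK.
have := D T Tcont Trank.
have norm_a_gt0 : 0 < `|quotient_proj E a| by rewrite normr_gt0.
have bound_sum : ubound [set `|q + T q| | q in [set q | `|q| <= 1]] 1.
  move=> _ [q /= q1 <-]; rewrite (le_trans _ q1)//.
  apply: le_quotient_norm => x <-.
  by rewrite /T phiE scaleNr -quotient_projZ -scaleN1r -quotient_projZ -quotient_projD scaleN1r.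
have sum_le1 : operator_norm (fun q => q + T q) <= 1.
  by apply: ge_sup => //; exists `|0 + T 0|, 0 => //=; rewrite normr0.
(* The normalized class of [a] is an eigenvector for the eigenvalue -1. *)
have T_gt0 : 0 < operator_norm T.
  apply: (@lt_le_trans _ _ `|T (`|quotient_proj E a|^-1 *: quotient_proj E a)|).
    rewrite -quotient_projZ normr_gt0 /T phiE linearZ/= fa scaler_eq0 negb_or proj_a_neq0 andbT.
    by rewrite oppr_eq0 mulf_neq0 ?oner_neq0// invr_neq0// normr_eq0.
  apply: ub_le_sup.
    exists `|quotient_proj E a| => _ [q /= q1 <-].
    by rewrite (le_trans (T_le q))// ger_pMr.
  exists (`|quotient_proj E a|^-1 *: quotient_proj E a) => //=.
  by rewrite normrZ normfV normr_id mulVf ?normr_eq0.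
by move=> N; move: sum_le1; rewrite N gerDl leNgt T_gt0.
Qed.
End rank_one_deflation.

Section complemented_range.
Variables (R : realType) (V X : normedModType R).
Variables (Phi : {linear X -> V}) (c : {linear V -> X}).
Hypotheses (Phi_cont : continuous Phi) (c_cont : continuous c).
Hypothesis PhiK : cancel Phi c.

Let fixed : set V := [set v | Phi (c v) = v].

Let fixed_submod : submod_closed (mem fixed).
Proof.
split; first by rewrite in_setE /fixed/= !linear0.
move=> k u v; rewrite !in_setE /fixed/= => uE vE.
by rewrite !linearP uE vE.
Qed.

Let fixed_closed : closed fixed.
Proof.
have -> : fixed = (fun v => Phi (c v) - v) @^-1` [set 0].
  by apply/seteqP; split=> v /= => [->|/eqP]; rewrite ?subrr// subr_eq0 => /eqP.
have contPhic : continuous (fun v => Phi (c v) - v).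
  move=> v; apply: cvgB; last exact: cvg_id.
  exact: continuous_comp (@c_cont v) (@Phi_cont (c v)).
apply: preimage_closed; last first.
  by apply: accessible_closed_set1; apply: hausdorff_accessible; exact: norm_hausdorff.
by move=> v _; exact: contPhic.
Qed.

(** A left inverse [c] of [Phi] makes [Phi \o c] a continuous projection onto the
    range of [Phi]: its fixed points form a closed set, with no appeal to the
    completeness of [X]. *)
Lemma complemented_range_subspace : exists E : closed_subspace V,
  (forall v, (E : set V) v <-> Phi (c v) = v) /\ isomorphic (subspace_type E) X.
Proof.
pose E := ClosedSubspace fixed_submod fixed_closed.
exists E; split=> //.
pose F (v : subspace_type E) : X := c (\val v).
have Flin : linear F by move=> k u v; rewrite /F !linearP.
have PhiE x : Phi x \in subspace_pred E by rewrite in_setE/= /fixed/= PhiK.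
pose G (x : X) : subspace_type E := SubspaceElt (PhiE x).
have Glin : linear G by move=> k x y; apply: val_inj; rewrite [RHS]linearP /= linearP.
pose F' : {linear _ -> _} := HB.pack F (GRing.isLinear.Build _ _ _ _ F Flin).
pose G' : {linear _ -> _} := HB.pack G (GRing.isLinear.Build _ _ _ _ G Glin).
exists F', G'; split.
- move=> v; apply: val_inj => /=.
  by have := valP v; rewrite in_setE.
- by move=> x /=; rewrite /F/= PhiK.
- have [C _ cC] := bound_of_continuous c_cont.
  by apply: (@continuous_of_bound _ _ _ F' C) => v; exact: cC.
- have [C _ PhiC] := bound_of_continuous Phi_cont.
  by apply: (@continuous_of_bound _ _ _ G' C) => x; exact: PhiC.
Qed.
End complemented_range.

(** * The subspace spanned by a perturbed dense sequence *)

Section quotient_construction.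
Context d (T : measurableType d) (R : realType).
Variable mu : {finite_measure set T -> \bar R}.
Local Notation L := (LspaceType1 mu).

Lemma eq_Rintegral_ae (D : set T) (f g : T -> R) : measurable D ->
  measurable_fun setT f -> measurable_fun setT g ->
  {ae mu, forall x, f x = g x} -> \int[mu]_(x in D) f x = \int[mu]_(x in D) g x.
Proof.
move=> mD mf mg fg; congr fine; apply: ae_eq_integral => //.
- by apply/measurable_EFinP; exact: measurable_funTS.
- by apply/measurable_EFinP; exact: measurable_funTS.
- by apply: filterS fg => x -> _.
Qed.

Variables (A : set T) (B : (set T)^nat).
Hypotheses (mA : measurable A) (mB : forall n, measurable (B n)).
Hypotheses (tB : trivIset setT B) (AB : forall n, A `&` B n = set0).
Hypotheses (A_gt0 : (0 < mu A)%E) (B_gt0 : forall n, (0 < mu (B n))%E).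
Variable h : nat -> L.
Hypothesis h_dense : forall v e, 0 < e -> exists n, `|v - h n| < e.

(** Valued in [R^o], the codomain for which continuity and linearity of a
    functional are those of a map between normed modules. *)
Definition mass (v : L) : R^o := \int[mu]_(x in A) Lspace1_fun v x.

Let integrable_on (v : L) D : measurable D -> mu.-integrable D (EFin \o Lspace1_fun v).
Proof. by move=> mD; apply: integrableS (Lspace1_integrable v). Qed.

Lemma mass_linear : linear mass.
Proof.
move=> k u v; rewrite /mass.
rewrite (@eq_Rintegral_ae _ _ (fun x => k * Lspace1_fun u x + Lspace1_fun v x))//.
- rewrite RintegralD//; [|exact: (integrableZl _ k (integrable_on u mA))|exact: integrable_on].
  by rewrite RintegralZl//; exact: integrable_on.
- exact: Lspace1_measurable.
- by apply: measurable_funD; [apply: measurable_funM => //|]; exact: Lspace1_measurable.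
- by apply: filterS2 (Lspace1_addE (k *: u) v) (Lspace1_scaleE k u) => x -> ->.
Qed.

HB.instance Definition _ := GRing.isLinear.Build _ _ _ _ mass mass_linear.

Lemma mass_le v : `|mass v| <= `|v|.
Proof.
rewrite -lee_fin EFin_normr_Rintegral//; last exact: integrable_on.
rewrite (le_trans (le_abse_integral _ _ _))//; first exact: measurable_int (integrable_on v mA).
rewrite (@Lspace1_normE_ae _ _ _ _ v (Lspace1_fun v)); last 2 first.
- exact: Lspace1_measurable.
- exact: aeW.
apply: ge0_subset_integral => //.
by apply/measurable_EFinP; apply: measurableT_comp => //; exact: Lspace1_measurable.
Qed.

Let cut_integrable (v : L) : mu.-integrable setT (EFin \o (fun x => Lspace1_fun v x * \1_A x)).
Proof.
apply: le_integrable (Lspace1_integrable v) => //.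
  by apply/measurable_EFinP; apply: measurable_funM => //; exact: Lspace1_measurable.
by move=> x _; rewrite lee_fin normrM ler_piMr// indicE; case: (x \in A); rewrite ?normr0 ?normr1.
Qed.

Definition cut (v : L) : L := Lspace1_class (cut_integrable v).

Lemma cutE v : {ae mu, forall x, Lspace1_fun (cut v) x = Lspace1_fun v x * \1_A x}.
Proof. by move: (Lspace1_classE (cut_integrable v)); apply: filterS => t; exact. Qed.

Lemma cut_linear : linear cut.
Proof.
move=> k u v; apply: Lspace1_ext.
apply: filterS3 (filterI (cutE (k *: u + v)) (cutE u)) (filterI (cutE v)
  (Lspace1_addE (k *: cut u) (cut v))) (filterI (Lspace1_scaleE k (cut u))
  (filterI (Lspace1_addE (k *: u) v) (Lspace1_scaleE k u))).
move=> x [-> uE] [vE ->] [-> [-> ->]] _.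
by rewrite uE vE mulrDl mulrA.
Qed.

HB.instance Definition _ := GRing.isLinear.Build _ _ _ _ cut cut_linear.

(** [cut v] and [v - cut v] have disjoint supports. *)
Lemma cut_norm v : `|cut v| + `|v - cut v| = `|v|.
Proof.
have mv := Lspace1_measurable v.
apply: EFin_inj; rewrite EFinD (Lspace1_norm_class (cut_integrable v)).
rewrite (@Lspace1_normE_ae _ _ _ _ (v - cut v) (fun x => Lspace1_fun v x * (1 - \1_A x))); last 2 first.
- by apply: measurable_funM => //; exact: measurable_funB.
- apply: filterS3 (cutE v) (Lspace1_oppE (cut v)) (Lspace1_addE v (- cut v)) => x cx ox ->.
  by rewrite [Lspace1_fun (- _) _]ox cx mulrBr mulr1.
rewrite -ge0_integralD//; last 2 first.
- by apply/measurable_EFinP; apply: measurableT_comp => //; exact: measurable_funM.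
- by apply/measurable_EFinP; apply: measurableT_comp => //; apply: measurable_funM => //; exact: measurable_funB.
rewrite (@Lspace1_normE_ae _ _ _ _ v (Lspace1_fun v))//; last exact: aeW.
apply: eq_integral => x _; rewrite -EFinD indicE; congr EFin.
by case: (x \in A); rewrite ?subrr ?subr0 mulr0 mulr1 normr0 ?addr0 ?add0r.
Qed.

Lemma mass_cut v : mass (cut v) = mass v.
Proof.
rewrite /mass (@eq_Rintegral_ae _ _ (fun x => Lspace1_fun v x * \1_A x))//.
- by apply: eq_Rintegral => x xA; rewrite indicE xA mulr1.
- exact: Lspace1_measurable.
- by apply: measurable_funM => //; exact: Lspace1_measurable.
- exact: cutE.
Qed.

Let bump_integrable D : measurable D ->
  mu.-integrable setT (EFin \o (fun x => (fine (mu D))^-1 * \1_D x)).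
Proof.
by move=> mD; apply: (integrableZl _ _ (integrable_indic _ _)).
Qed.

Definition bump D (mD : measurable D) : L := Lspace1_class (bump_integrable mD).

Lemma bumpE D (mD : measurable D) :
  {ae mu, forall x, Lspace1_fun (bump mD) x = (fine (mu D))^-1 * \1_D x}.
Proof. by move: (Lspace1_classE (bump_integrable mD)); apply: filterS => t; exact. Qed.

Lemma bump_norm D (mD : measurable D) : (0 < mu D)%E -> `|bump mD| = 1.
Proof.
move=> D0; have Dfin : mu D \is a fin_num by rewrite fin_num_measure.
have mD0 : 0 < fine (mu D) by rewrite fine_gt0// D0 ltey_eq Dfin.
apply: EFin_inj; rewrite Lspace1_norm_class.
rewrite (eq_integral (fun x => (fine (mu D))^-1%:E * (\1_D x)%:E)%E); last first.
  by move=> x _; rewrite -EFinM ger0_norm// mulr_ge0// invr_ge0 ltW.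
rewrite ge0_integralZl ?lee_fin ?invr_ge0 ?(ltW mD0)//; last exact/measurable_EFinP.
by rewrite integral_indic// setIT -[X in (_ * X)%E]fineK// -EFinM mulVf// gt_eqF.
Qed.

Local Notation a := (bump mA).

Lemma mass_bump : mass a = 1.
Proof.
have Afin : mu A \is a fin_num by rewrite fin_num_measure.
rewrite /mass (@eq_Rintegral_ae _ _ (fun x => (fine (mu A))^-1 * \1_A x))//.
- rewrite (@eq_Rintegral _ _ _ _ _ (fun=> (fine (mu A))^-1)); last by move=> x xA; rewrite indicE xA mulr1.
  by rewrite Rintegral_cst// mulVf// gt_eqF// fine_gt0// A_gt0 ltey_eq Afin.
- exact: Lspace1_measurable.
- exact: measurable_funM.
- exact: bumpE.
Qed.

Lemma mass_bumpB n : mass (bump (mB n)) = 0.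
Proof.
rewrite /mass (@eq_Rintegral_ae _ _ (fun x => (fine (mu (B n)))^-1 * \1_(B n) x))//.
- rewrite (@eq_Rintegral _ _ _ _ _ (fun=> 0)); first by rewrite Rintegral_cst// mul0r.
  move=> x; rewrite inE => xA; rewrite indicE memNset ?mulr0// => xB.
  by have : (A `&` B n) x by []; rewrite AB.
- exact: Lspace1_measurable.
- exact: measurable_funM.
- exact: bumpE.
Qed.

(* The [n]-th coefficient of [v] is the integral of [v] over [B n]. *)
Let coef_kernel (z : T * nat) : R := \1_(B z.2) z.1.

Let m_coef_kernel : measurable_fun setT coef_kernel.
Proof. by apply: measurable_fun_prod_nat => n; exact/measurable_indic/mB. Qed.

Let coef_kernel_le x : (\int[@counting nat R]_n `|coef_kernel (x, n)|%:E <= 1%:E)%E.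
Proof.
rewrite ge0_integral_count//.
rewrite (eq_eseriesr (g := fun n => \d_x (B n))); last first.
  by move=> n _; rewrite /coef_kernel/= ger0_norm// diracE.
have -> : (\sum_(n <oo) \d_x (B n) = \d_x (\bigcup_n B n) :> \bar R)%E.
  by rewrite measure_bigcup//; apply: eq_eseriesl => n; rewrite in_setT.
by rewrite diracE lee_fin; case: (x \in _).
Qed.

Let coef : L -> ell1 R :=
  @kernel_operator _ _ _ _ R mu
    (@counting nat R : {sigma_finite_measure set nat -> \bar R})
    coef_kernel 1 m_coef_kernel coef_kernel_le.

Let coef_linear : linear coef.
Proof. exact: kernel_operator_linear. Qed.

HB.instance Definition _ := GRing.isLinear.Build _ _ _ _ coef coef_linear.

Let coefE v n : Lspace1_fun (coef v) n = \int[mu]_x (Lspace1_fun v x * \1_(B n) x).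
Proof. by move: n; apply: ae_countingP; exact: kernel_operatorE. Qed.

(* The [n]-th block is [b n + cut (h n) / |cut (h n)|]; if [cut (h n) = 0] the
   convention [0^-1 = 0] leaves [b n] alone. *)
Let block_kernel (z : nat * T) : R := (fine (mu (B z.1)))^-1 * \1_(B z.1) z.2 +
  `|cut (h z.1)|^-1 * (Lspace1_fun (h z.1) z.2 * \1_A z.2).

Let m_block_kernel : measurable_fun setT block_kernel.
Proof.
apply: measurable_fun_nat_prod => n; apply: measurable_funD.
  by apply: measurable_funM => //=; exact: measurable_indic.
by apply: measurable_funM => //=; apply: measurable_funM => //; exact: Lspace1_measurable.
Qed.

Let block_kernel_le n : (\int[mu]_x `|block_kernel (n, x)|%:E <= 2%:E)%E.
Proof.
have -> : (\int[mu]_x `|block_kernel (n, x)|%:E = `|bump (mB n) + `|cut (h n)|^-1 *: cut (h n)|%:E)%E.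
  apply/esym/Lspace1_normE_ae; first by apply: (measurableT_comp m_block_kernel); exact: measurable_pair1.
  apply: filterS3 (filterI (bumpE (mB n)) (cutE (h n)))
    (Lspace1_addE (bump (mB n)) (`|cut (h n)|^-1 *: cut (h n)))
    (Lspace1_scaleE (`|cut (h n)|^-1) (cut (h n))).
  by move=> x [bE cE] -> sE; rewrite [Lspace1_fun (_ *: _) _]sE bE cE.
rewrite lee_fin (le_trans (ler_normD _ _))// [leRHS](_ : _ = 1 + 1)// lerD//.
  by rewrite bump_norm.
rewrite normrZ normfV normr_id; have [->|c0] := eqVneq (`|cut (h n)|) 0.
  by rewrite mulr0.
by rewrite mulVf.
Qed.

Let synth0 : ell1 R -> L :=
  @kernel_operator _ _ _ _ R
    (@counting nat R : {sigma_finite_measure set nat -> \bar R})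
    mu block_kernel 2 m_block_kernel block_kernel_le.

Let synth0_linear : linear synth0.
Proof. exact: kernel_operator_linear. Qed.

HB.instance Definition _ := GRing.isLinear.Build _ _ _ _ synth0 synth0_linear.

Let synth0E u : {ae mu, forall x, Lspace1_fun (synth0 u) x =
  \int[@counting nat R]_n (Lspace1_fun u n * block_kernel (n, x))}.
Proof. exact: kernel_operatorE. Qed.

(* Removing the multiple of [a] after summation rather than from each block makes
   [mass (synth u) = 0] immediate. *)
Let synth (u : ell1 R) : L := synth0 u - mass (synth0 u) *: a.

Let synth_linear : linear synth.
Proof.
move=> k u v; rewrite /synth linearP linearP/= scalerBr scalerDl opprD addrACA.
by rewrite scalerA.
Qed.

HB.instance Definition _ := GRing.isLinear.Build _ _ _ _ synth synth_linear.

Let synth_mass u : mass (synth u) = 0.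
Proof. by rewrite /synth linearB linearZ/= mass_bump /GRing.scale/= mulr1 subrr. Qed.

Let indic_disjoint n x : B n x -> \1_A x = 0 :> R.
Proof.
by move=> Bx; rewrite indicE memNset// => Ax; have : (A `&` B n) x by []; rewrite AB.
Qed.

Let coef_bumpA n : Lspace1_fun (coef a) n = 0.
Proof.
rewrite coefE (@eq_Rintegral_ae _ _ (fun=> 0))//.
- by rewrite Rintegral_cst// mul0r.
- by apply: measurable_funM; [exact: Lspace1_measurable|exact/measurable_indic/mB].
apply: filterS (bumpE mA) => x ->.
have [Bx|nBx] := pselect (B n x); first by rewrite (indic_disjoint Bx) mulr0 mul0r.
by rewrite [\1_(B n) x]indicE memNset// mulr0.
Qed.

Let Bfin n : mu (B n) \is a fin_num. Proof. by rewrite fin_num_measure. Qed.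

Let Bpos n : 0 < fine (mu (B n)).
Proof. by rewrite fine_gt0// B_gt0 ltey_eq Bfin. Qed.

Let block_kernel_on n x m : B n x -> m != n -> block_kernel (m, x) = 0.
Proof.
move=> Bx mn; rewrite /block_kernel/= (indic_disjoint Bx) indicE memNset ?mulr0 ?addr0// => Bmx.
by move/eqP: mn; apply; apply: tB => //; exists x.
Qed.

(* On [B n] only the [n]-th block is nonzero, with constant value 1 / mu (B n). *)
Let coef_synth0 u n : Lspace1_fun (coef (synth0 u)) n = Lspace1_fun u n.
Proof.
rewrite coefE (@eq_Rintegral_ae _ _
    (fun x => (Lspace1_fun u n / fine (mu (B n))) * \1_(B n) x))//.
- rewrite RintegralZl//; last exact: integrable_indic.
  rewrite /Rintegral integral_indic// setIT.
  by rewrite divfK// gt_eqF.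
- by apply: measurable_funM; [exact: Lspace1_measurable|exact/measurable_indic/mB].
- by apply: measurable_funM => //; exact/measurable_indic/mB.
apply: filterS (synth0E u) => x ->.
have [Bx|nBx] := pselect (B n x); last by rewrite indicE memNset// !mulr0.
rewrite (@Rintegral_counting1 _ _ n); last by move=> m mn; rewrite (block_kernel_on Bx mn) mulr0.
by rewrite /block_kernel/= (indic_disjoint Bx) !mulr0 addr0 indicE mem_set// !mulr1.
Qed.

Let coefK : cancel synth coef.
Proof.
move=> u; apply: ell1_ext => n.
rewrite /synth linearB linearZ/= -scaleNr ell1_addE ell1_scaleE.
by rewrite coef_bumpA coef_synth0 mulr0 addr0.
Qed.

Let unit_integrable n : (@counting nat R).-integrable setT (EFin \o (fun m => \1_[set n] m)).
Proof.
apply/integrableP; split=> //.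
rewrite (eq_integral (fun m => (\1_[set n] m)%:E)); last first.
  by move=> m _ /=; rewrite ger0_norm.
rewrite integral_indic// setIT.
by rewrite (le_lt_trans (y := 1%E)) ?ltry// -(@counting_set1 R n).
Qed.

Let synth0_unit n : synth0 (Lspace1_class (unit_integrable n)) =
  bump (mB n) + `|cut (h n)|^-1 *: cut (h n).
Proof.
apply: Lspace1_ext.
apply: filterS3 (filterI (bumpE (mB n)) (cutE (h n)))
  (filterI (synth0E (Lspace1_class (unit_integrable n)))
    (Lspace1_addE (bump (mB n)) (`|cut (h n)|^-1 *: cut (h n))))
  (Lspace1_scaleE (`|cut (h n)|^-1) (cut (h n))).
move=> x [bE cE] [-> ->] sE _; rewrite [Lspace1_fun (_ *: _) _]sE bE cE.
rewrite (@Rintegral_counting1 _ _ n); last first.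
  by move=> m mn; rewrite ell1_classE indicE memNset ?mul0r//; exact/eqP.
by rewrite ell1_classE indicE mem_set// mul1r.
Qed.

Section deflation.
Variable E : closed_subspace L.
Hypothesis E_synth : forall u, (E : set L) (synth u).

Local Notation pi := (quotient_proj E).

(* Up to the factor [|cut (h n)|], the left-hand vector is [synth (unit n) - b n],
   and [synth (unit n)] lies in [E]. *)
Let deflation_dense_le n : `|pi (cut (h n) - mass (h n) *: a)| <= `|cut (h n)|.
Proof.
have [c0|c0] := eqVneq (`|cut (h n)|) 0.
  by rewrite -mass_cut (normr0_eq0 c0) linear0 scale0r subr0 quotient_proj_norm_le.
have -> : cut (h n) - mass (h n) *: a =
    `|cut (h n)| *: (synth (Lspace1_class (unit_integrable n)) - bump (mB n)).
  have mass_unit : mass (synth0 (Lspace1_class (unit_integrable n))) =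
      `|cut (h n)|^-1 * mass (h n).
    by rewrite synth0_unit (linearD mass) (linearZ_LR mass)/= mass_bumpB add0r mass_cut.
  rewrite /synth mass_unit synth0_unit addrAC [bump _ + _]addrC addrK scalerBr !scalerA.
  by rewrite mulrA divff// mul1r scale1r.
rewrite quotient_projZ normrZ normr_id ler_piMr//.
have -> : pi (synth (Lspace1_class (unit_integrable n)) - bump (mB n)) = - pi (bump (mB n)).
  by rewrite quotient_projD (quotient_proj_eq0 _ _).2 // add0r -scaleN1r quotient_projZ scaleN1r.
by rewrite normrN (le_trans (quotient_proj_norm_le _ _))// bump_norm.
Qed.

Let cut_norm_le v : `|cut v| <= `|v|.
Proof. by rewrite -(cut_norm v) lerDl. Qed.

(* Both sides are Lipschitz in [v], and the inequality holds on a dense sequence. *)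
Let deflation_cut_le v : `|pi (cut v - mass v *: a)| <= `|cut v|.
Proof.
apply/ler_addgt0Pr => e e0; have [n vn] := h_dense v (divr_gt0 e0 (ltr0Sn R 2)).
have -> : cut v - mass v *: a =
    (cut (h n) - mass (h n) *: a) + (cut (v - h n) - mass (v - h n) *: a).
  by rewrite (linearB cut) (linearB mass) scalerBl addrACA -opprD !subrKC.
rewrite quotient_projD (le_trans (ler_normD _ _))//.
rewrite (le_trans (lerD (deflation_dense_le n) (quotient_proj_norm_le _ _)))//.
have -> : cut (h n) = cut v - cut (v - h n) by rewrite linearB/= opprB addrC subrK.
rewrite (le_trans (lerD (ler_normB _ _) (ler_normB _ _)))// normrZ bump_norm// mulr1.
have := cut_norm_le (v - h n); have := mass_le (v - h n); move: vn.
by set x := `|v - h n|; set y := `|mass _|; set z := `|cut (v - _)|; set t := `|cut v|; lra.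
Qed.

(** The part of [v] outside [A] is untouched, and norms over [A] and its
    complement add up. *)
Lemma deflation_le v : `|pi (v - mass v *: a)| <= `|v|.
Proof.
have -> : v - mass v *: a = (v - cut v) + (cut v - mass v *: a) by rewrite addrA subrK.
rewrite quotient_projD (le_trans (ler_normD _ _))// -(cut_norm v) addrC lerD//.
exact: quotient_proj_norm_le.
Qed.
End deflation.

Let synth_bounded u : `|synth u| <= 4 * `|u|.
Proof.
have s0 : `|synth0 u| <= 2 * `|u| by exact: kernel_operator_bounded.
rewrite (le_trans (ler_normB _ _))// normrZ bump_norm// mulr1.
by have := mass_le (synth0 u); lra.
Qed.

(** The coefficients of [synth u] are those of [u], hence [synth] embeds l1 onto
    a complemented subspace. *)
Lemma ell1_quotient_not_daugavet : exists E : closed_subspace L,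
  isomorphic (subspace_type E) (ell1 R) /\ ~ daugavet_property (quotient_space E).
Proof.
have synth_cont : continuous synth by exact: continuous_of_bound synth_bounded.
have coef_cont : continuous coef.
  by apply: (@continuous_of_bound _ _ _ coef 1) => v; exact: kernel_operator_bounded.
have [E [EP Eiso]] := complemented_range_subspace synth_cont coef_cont coefK.
exists E; split=> //.
apply: (@deflation_not_daugavet _ _ _ mass a) => //.
- exact: mass_le.
- by move=> v /EP <-; exact: synth_mass.
- exact: mass_bump.
- by apply: deflation_le => u; apply/EP; rewrite /= [coef _]coefK.
Qed.

End quotient_construction.

(** * Rational step functions are dense in L1[0,1] *)

Section unit_interval_density.
Variable R : realType.
Local Notation leb := (@lebesgue_measure R).

Definition leb01 := mrestr leb (@measurable_itv R `[0, 1]).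

HB.instance Definition _ := Measure.on leb01.

Let leb01_finite : (leb01 setT < +oo)%E.
Proof. by rewrite /leb01 /mrestr setTI lebesgue_measure_itv/= lte_fin ltr01 -EFinB ltry. Qed.

HB.instance Definition _ := Measure_isFinite.Build _ _ _ leb01
  (lty_fin_num_fun leb01_finite).

Lemma ge0_integral_leb01 (g : R -> \bar R) : measurable_fun (setT : set (measurableTypeR R)) g ->
  (forall x, 0 <= g x)%E -> (\int[leb01]_x g x = \int[leb]_(x in `[0%R, 1%R]) g x)%E.
Proof.
pose I01 : set (measurableTypeR R) := `[0%R, 1%R]%classic.
move=> mg g0; rewrite (@ge0_negligible_integral _ _ _ leb01 setT (~` I01))//; first last.
- by rewrite /= /leb01 /mrestr setICl measure0.
- by apply: measurableC; exact: measurable_itv.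
rewrite setTD setCK; apply: eq_measure_integral => A mA A01.
by rewrite /= /leb01 /mrestr setIidl.
Qed.

(** Uniform continuity on a segment, obtained from the covering form of
    compactness: near each point a common modulus works. *)
Lemma heine_segment (g : R -> R) (a b e : R) : continuous g -> 0 < e ->
  \forall N \near \oo, forall x, x \in `[a, b] -> forall y, `|x - y| <= N.+1%:R^-1 ->
    `|g x - g y| < e.
Proof.
move=> cg e0.
have /compact_near_coveringP/(_ nat \oo (fun N x => forall y, `|x - y| <= N.+1%:R^-1 ->
    `|g x - g y| < e) _) := @segment_compact R a b.
apply.
move=> x _; have e20 : 0 < e / 2 by rewrite divr_gt0.
have /cvgrPdist_lt/(_ _ e20)/nbhs_ballP[r /= r0 rg] := cg x.
have r20 : 0 < r / 2 by rewrite divr_gt0.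
near=> x' N => y x'y.
have xx' : `|x - x'| < r / 2 by near: x'; apply/nbhs_ballP; exists (r / 2).
have Nr : N.+1%:R^-1 < r / 2 by near: N; exact: near_infty_natSinv_lt (PosNum r20).
have gx' : `|g x - g x'| < e / 2.
  by apply: rg; rewrite /ball/= (lt_trans xx')// ltr_pdivrMr// mulr_natr mulr2n ltrDl.
have gy : `|g x - g y| < e / 2.
  apply: rg; rewrite /ball/= [r]splitr (le_lt_trans (ler_distD x' _ _))// ltrD//.
  exact: le_lt_trans Nr.
rewrite [e]splitr (le_lt_trans (ler_distD (g x) _ _))// ltrD//.
by rewrite distrC.
Unshelve. all: by end_near. Qed.

Definition grid_cell (N i : nat) : set R := `[i%:R / N%:R, i.+1%:R / N%:R[%classic.

(** The intervals are indexed by [i <= N] where the grid has step [1 / N], so that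
    the last cell starts at 1 and the point 1 is covered; hence
    [N = (size s).-1]. *)
Definition rat_step (s : seq rat) (x : R) : R :=
  \sum_(i < size s) ratr (nth 0 s i) * \1_(grid_cell (size s).-1 i) x.

Lemma rat_stepE s x : (1 < size s)%N -> x \in `[0, 1] ->
  exists2 i : nat, (i < size s)%N &
    rat_step s x = ratr (nth 0 s i) /\ `|x - i%:R / (size s).-1%:R| <= (size s).-1%:R^-1.
Proof.
case: s => [//|q s] /= s0; rewrite in_itv/= => /andP[x0 x1].
set N := size s; have N0 : 0 < N%:R :> R by rewrite ltr0n.
have xN0 : 0 <= x * N%:R by rewrite mulr_ge0// ltW.
have /andP[ix xi] := truncn_itv xN0.
set i := Num.trunc (x * N%:R) in ix xi.
have iN : (i < N.+1)%N.
  rewrite ltnS -(ler_nat R) (le_trans ix)// ler_piMl// ltW.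
exists i => //; split; last first.
  rewrite ger0_norm ?subr_ge0 ?ler_pdivrMr// lerBlDr.
  by rewrite -[X in X + _]mul1r -mulrDl ler_pdivlMr// addrC natr1 ltW.
rewrite /rat_step /= (bigD1 (Ordinal iN))//= big1 ?addr0 => [|j ji].
  by rewrite indicE mem_set ?mulr1// /grid_cell/= in_itv/= ler_pdivrMr// ltr_pdivlMr// ix.
rewrite indicE memNset ?mulr0// /grid_cell/= in_itv/= ler_pdivrMr// ltr_pdivlMr// => /andP[jx xj].
move/eqP: ji; apply; apply: val_inj => /=; apply/eqP; rewrite eqn_leq.
rewrite -ltnS -(ltr_nat R) (le_lt_trans jx xi)/=.
by rewrite -ltnS -(ltr_nat R) (le_lt_trans ix xj).
Qed.

Lemma measurable_rat_step s : measurable_fun setT (rat_step s).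
Proof.
apply: measurable_sum => i; apply: measurable_funM => //.
by apply: measurable_indic; exact: measurable_itv.
Qed.

Lemma rat_step_integrable s : leb01.-integrable setT (EFin \o rat_step s).
Proof.
rewrite (_ : _ \o _ = (fun x => \sum_(i < size s)
  ((ratr (nth 0 s i))%:E * (\1_(grid_cell (size s).-1 i) x)%:E))%E).
  apply: integrable_sum => // i _; apply: integrableZl => //.
  by apply: integrable_indic => //; exact: measurable_itv.
by apply/funext => x; rewrite /= /rat_step -sumEFin; apply: eq_bigr => i _; rewrite EFinM.
Qed.

Lemma rat_step_approx (g : R -> R) (e : R) : continuous g -> 0 < e ->
  exists s, forall x, x \in `[0, 1] -> `|g x - rat_step s x| <= e.
Proof.
move=> cg e0; have e20 : 0 < e / 2 by rewrite divr_gt0.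
have [N _ gN] := heine_segment 0 1 cg e20; have {}gN := gN N (leqnn N).
have /choice[q qP] : forall i : nat, exists q : rat,
    ratr q \in `](g (i%:R / N.+1%:R) - e / 2), (g (i%:R / N.+1%:R) + e / 2)[.
  by move=> i; apply: rat_in_itvoo; rewrite ltrD2l gtrN.
(* Two more entries than the index [N]: the grid has step 1 / N.+1. *)
exists (mkseq q N.+2) => x x01.
have [|i] := @rat_stepE (mkseq q N.+2) x _ x01; first by rewrite size_mkseq.
rewrite size_mkseq => iN [-> xi]; rewrite nth_mkseq//.
have := gN x x01 _ xi; have := qP i; rewrite in_itv/= => /andP[q1 q2].
by rewrite ltr_norml ler_norml => /andP[g1 g2]; apply/andP; split; lra.
Qed.

Definition rat_step_class (n : nat) : LspaceType1 leb01 :=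
  Lspace1_class (rat_step_integrable (odflt [::] (unpickle n))).

(** Continuous functions are dense in L1, and a uniform approximation on [0, 1] is
    an approximation in L1. *)
Lemma rat_step_dense (v : LspaceType1 leb01) (e : R) : 0 < e ->
  exists n, `|v - rat_step_class n| < e.
Proof.
move=> e0; have e20 : 0 < e / 2 by rewrite divr_gt0.
have mv := Lspace1_measurable v.
have iv : leb.-integrable `[0%R, 1%R] (EFin \o Lspace1_fun v).
  apply/integrableP; split; first by apply/measurable_EFinP; exact: measurable_funTS.
  rewrite -ge0_integral_leb01//; last by apply: measurableT_comp => //; exact/measurable_EFinP.
  by have /integrableP[] := Lspace1_integrable v.
have lebfin : (leb `[0%R, 1%R] < +oo)%E.
  by rewrite lebesgue_measure_itv/= lte_fin ltr01 -EFinB ltry.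
have [g [cg ig gv]] := approximation_continuous_integrable (measurable_itv _) lebfin iv.
have {gv} [n vg] : exists n, (\int[leb]_(z in `[0%R, 1%R]) `|(Lspace1_fun v z - g n z)%:E| < (e / 2)%:E)%E.
  have /fine_cvgP[fin /cvgrPdist_lt/(_ _ e20)] := gv.
  move=> /(filterI fin)[n _ /(_ n (leqnn n))[/= nfin]].
  rewrite sub0r normrN ger0_norm ?fine_ge0 ?integral_ge0// => nlt; exists n.
  by rewrite -[ltLHS]fineK.
have e30 : 0 < e / 3 by rewrite divr_gt0.
have [s gs] := rat_step_approx (cg n) e30.
exists (pickle s).
rewrite -lte_fin (@Lspace1_normE_ae _ _ _ _ _ (fun x => Lspace1_fun v x - rat_step s x)); first last.
- apply: filterS3 (Lspace1_classE (rat_step_integrable s)) (Lspace1_oppE (rat_step_class (pickle s)))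
    (Lspace1_addE v (- rat_step_class (pickle s))).
  move=> x /(_ I) sE oE ->; rewrite [Lspace1_fun (- _) _]oE; congr (_ - _).
  by rewrite /rat_step_class pickleK /= sE.
- by apply: measurable_funB => //; exact: measurable_rat_step.
rewrite ge0_integral_leb01//; last first.
  apply/measurable_EFinP; apply: measurableT_comp => //.
  by apply: measurable_funB => //; exact: measurable_rat_step.
have mg : measurable_fun setT (g n) by exact: continuous_measurable_fun.
apply: (@le_lt_trans _ _ (\int[leb]_(z in `[0%R, 1%R]) (`|(Lspace1_fun v z - g n z)%:E| + (e / 3)%:E))%E).
  apply: ge0_le_integral => //.
  - apply/measurable_EFinP; apply: measurable_funTS; apply: measurableT_comp => //.
    by apply: measurable_funB => //; exact: measurable_rat_step.
  - apply: emeasurable_funD => //; apply: measurableT_comp => //; apply/measurable_EFinP.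
    by apply: measurable_funTS; exact: measurable_funB.
  move=> x /= x01; rewrite -EFinD lee_fin (le_trans (ler_distD (g n x) _ _))// lerD2l.
  exact: gs.
rewrite ge0_integralD//; last 2 first.
  apply: measurableT_comp => //; apply/measurable_EFinP.
  by apply: measurable_funTS; exact: measurable_funB.
  by move=> x _; rewrite lee_fin ltW.
rewrite integral_cst//= lebesgue_measure_itv/= lte_fin ltr01 -EFinB subr0 mule1.
rewrite [e in ltRHS](_ : e = e / 2 + e / 2); last by rewrite -splitr.
rewrite EFinD lte_leD//.
by rewrite lee_fin ler_wpM2l ?ltW// ltf_pV2 ?posrE// ltr_nat.
Qed.

Let half : set (measurableTypeR R) := `[2^-1, 1]%classic.

Let harmonic_cell (n : nat) : set (measurableTypeR R) :=
  `]n.+3%:R^-1, n.+2%:R^-1[%classic.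

Let leb01_half : (0 < leb01 half)%E.
Proof.
rewrite /leb01 /mrestr setIidl.
  by rewrite lebesgue_measure_itv/= lte_fin invf_lt1// ltr1n -EFinB lte_fin subr_gt0 invf_lt1// ltr1n.
move=> x; rewrite /half /= in_itv/= => /andP[x0 x1].
by change (x \in `[0, 1]); rewrite in_itv/= x1 (le_trans _ x0).
Qed.

Let harmonic_cell_lt n : n.+3%:R^-1 < n.+2%:R^-1 :> R.
Proof. by rewrite ltf_pV2 ?posrE// ltr_nat. Qed.

Let leb01_harmonic_cell n : (0 < leb01 (harmonic_cell n))%E.
Proof.
rewrite /leb01 /mrestr setIidl.
  rewrite lebesgue_measure_itv/= lte_fin harmonic_cell_lt.
  by rewrite -EFinB lte_fin subr_gt0 harmonic_cell_lt.
move=> x; rewrite /harmonic_cell /= in_itv/= => /andP[x0 x1].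
change (x \in `[0, 1]); rewrite in_itv/= (le_trans _ (ltW x0))//=.
by rewrite (le_trans (ltW x1))// invf_le1// ler1n.
Qed.

Let trivIset_harmonic_cell : trivIset setT harmonic_cell.
Proof.
have disj m n : (m < n)%N -> harmonic_cell m `&` harmonic_cell n = set0.
  move=> mn; rewrite -subset0 => x []; rewrite /harmonic_cell /half /= !in_itv/= => /andP[mx _] /andP[_ xn].
  have := lt_trans mx xn; rewrite ltf_pV2 ?posrE// ltr_nat.
  by rewrite !ltnS leqNgt mn.
move=> m n _ _; have [/disj mn|/disj nm|//] := ltngtP m n; first by rewrite mn => -[].
by rewrite setIC nm => -[].
Qed.

Let half_harmonic_cell n : half `&` harmonic_cell n = set0.
Proof.
rewrite -subset0 => x []; rewrite /harmonic_cell /half /= !in_itv/= => /andP[x2 _] /andP[_ xn].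
by have := le_lt_trans x2 xn; rewrite ltf_pV2 ?posrE// ltr_nat ltnS.
Qed.

Lemma L1_unit_interval_quotient_not_daugavet : exists E : closed_subspace (L1_unit_interval R),
  isomorphic (subspace_type E) (ell1 R) /\ ~ daugavet_property (quotient_space E).
Proof.
apply: (@ell1_quotient_not_daugavet _ _ _ leb01 half harmonic_cell _ _
  trivIset_harmonic_cell half_harmonic_cell leb01_half leb01_harmonic_cell
  rat_step_class rat_step_dense).
- exact: measurable_itv.
- by move=> n; exact: measurable_itv.
Qed.

End unit_interval_density.

(** * Invariance of the Radon-Nikodym property under isomorphism *)

Section nonmeasurable_monotonicity.
Context d (T : measurableType d) (R : realType).
Variable mu : {measure set T -> \bar R}.
Import HBNNSimple.

(** The integrands of Bochner approximations are norms of vector-valued maps, whose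
    measurability is not known: the comparison is made on the simple functions
    below [f], of which a multiple by [C^-1] lies below [g]. *)
Lemma ge0_le_integralZ (f g : T -> R) (C : R) : 0 < C ->
  (forall x, 0 <= f x <= C * g x) ->
  (\int[mu]_x (f x)%:E <= C%:E * \int[mu]_x (g x)%:E)%E.
Proof.
move=> C0 fg.
have g0 x : 0 <= g x.
  by have /andP[f0 /(le_trans f0)] := fg x; rewrite pmulr_rge0.
rewrite ge0_integralTE; last by move=> x; have /andP[] := fg x; rewrite lee_fin.
apply: ge_ereal_sup => _ [u /= uf <-].
have u_scaled x : u x = C * (C^-1 * u x) by rewrite mulrA divff ?mul1r// gt_eqF.
have Ci : 0 <= C^-1 by rewrite invr_ge0 ltW.
pose v := scale_nnsfun u Ci.
have -> : sintegral mu u = (C%:E * sintegral mu v)%E.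
  rewrite -!integralT_nnsfun -ge0_integralZl ?lee_fin ?(ltW C0)//; last 2 first.
    exact/measurable_EFinP.
    by move=> x _; rewrite lee_fin.
  by apply: eq_integral => x _; rewrite -EFinM /= -u_scaled.
rewrite lee_wpmul2l ?lee_fin ?(ltW C0)// ge0_integralTE; last by move=> x; rewrite lee_fin.
apply: ereal_sup_ubound; exists v => //= x; rewrite lee_fin ler_pdivrMl//.
have /andP[_ fgx] := fg x; rewrite (le_trans _ fgx)//.
by have := uf x; rewrite lee_fin.
Qed.

End nonmeasurable_monotonicity.

Section radon_nikodym_transfer.
Variables (R : realType) (X Y : normedModType R).

Lemma linear_simple_integral d (T : measurableType d) (mu : {finite_measure set T -> \bar R})
    (g : {linear Y -> X}) (A : set T) (s : T -> Y) : injective g -> simple_function s ->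
  simple_integral mu A (g \o s) = g (simple_integral mu A s).
Proof.
move=> g_inj [sfin _]; rewrite /simple_integral.
rewrite (@reindex_fsbig _ _ _ _ _ g (range s)); last first.
  split; last by move=> _ [x _ <-]; exists (s x) => //; exists x.
    by move=> _ [x _ <-]; exists x.
  by move=> x y _ _; exact: g_inj.
rewrite !fsbig_finite//= raddf_sum; apply: eq_bigr => y _.
rewrite [RHS](linearZ_LR g)/=; congr (fine (mu (_ `&` _)) *: _).
by apply/seteqP; split=> x /=; [exact: g_inj|move=> ->].
Qed.

(** An isomorphism carries the measure to [Y] and its inverse carries back the
    density together with its simple approximants. *)
Lemma radon_nikodym_isomorphic :
  isomorphic X Y -> radon_nikodym_property Y -> radon_nikodym_property X.
Proof.
move=> [f [g [fK gK fcont gcont]]] rnpY d T mu G Gvm Gfv Gac.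
have [C C0 fC] := bound_of_continuous fcont.
have [D D0 gD] := bound_of_continuous gcont.
have g_inj : injective g by exact: can_inj gK.
have [||A mA mA0|g' g'P] := rnpY d T mu (f \o G).
- move=> A mA tA; have := Gvm A mA tA => /(continuous_cvg _ (fcont (G (\bigcup_n A n)))).
  by apply: cvg_trans; apply: near_eq_cvg; apply: nearW => n; rewrite /= /series/= raddf_sum.
- have [M MG] := Gfv; exists (C * M) => n A mA tA.
  apply: le_trans (ler_wpM2l (ltW C0) (MG n A mA tA)).
  by rewrite mulr_sumr ler_sum// => i _; exact: fC.
- by rewrite /= Gac// linear0.
exists (g \o g') => A mA; have [s [s_simple s_cvg s_int] s_A] := g'P A mA.
exists (fun n => g \o s n); first split.
- move=> n; have [sfin smeas] := s_simple n; split.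
    have -> : range (g \o s n) = g @` range (s n) by rewrite image_comp.
    exact: finite_image.
  move=> x; have -> : (g \o s n) @^-1` [set x] = s n @^-1` [set f x].
    by apply/seteqP; split=> w /= => [<-|->]; rewrite ?gK ?fK.
  exact: smeas.
- by apply: filterS s_cvg => w sw; exact: (continuous_cvg _ (gcont (g' w)) sw).
- apply: (@squeeze_cvge _ _ _ _ (fun=> 0%E) _
      (fun n => D%:E * \int[mu]_w (`|g' w - s n w|%:E))%E).
  + apply: nearW => n; rewrite integral_ge0//=.
    by apply: ge0_le_integralZ => // w; rewrite normr_ge0/= -linearB gD.
  + exact: cvg_cst.
  + by rewrite -[X in _ --> X](mule0 D%:E); exact: cvgeZl.
have := s_A => /(continuous_cvg _ (gcont (f (G A)))); rewrite fK.
apply: cvg_trans; apply: near_eq_cvg; apply: nearW => n /=.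
by rewrite linear_simple_integral.
Qed.

End radon_nikodym_transfer.

(** * Scalar approximation and scalar densities *)

Section scalar_tools.
Context d (T : measurableType d) (R : realType).
Import HBNNSimple.

(** The approximants of the positive and negative parts lie below these parts, so
    the error is dominated by [|f|]: this is what allows dominated convergence
    simultaneously over all coordinates. *)
Lemma simple_approximation (f : T -> R) : measurable_fun setT f ->
  exists s : nat -> T -> R, [/\ forall n, measurable_fun setT (s n),
    forall n, finite_set (range (s n)),
    forall n x, `|f x - s n x| <= `|f x| &
    forall x, s n x @[n --> \oo] --> f x].
Proof.
move=> mf; have mp : measurable_fun setT (EFin \o f^\+).
  by apply/measurable_EFinP; exact: measurable_funrpos.
have mn : measurable_fun setT (EFin \o f^\-).
  by apply/measurable_EFinP; exact: measurable_funrneg.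
have f0mp y : (0 <= (EFin \o f^\+)%R y)%E by rewrite lee_fin.
have f0mn y : (0 <= (EFin \o f^\-)%R y)%E by rewrite lee_fin.
pose p := nnsfun_approx measurableT mp; pose m := nnsfun_approx measurableT mn.
have p_cvg x : p n x @[n --> \oo] --> f^\+ x.
  have /fine_cvgP[_] := cvg_nnsfun_approx measurableT mp (fun y _ => f0mp y) (I : setT x).
  exact.
have m_cvg x : m n x @[n --> \oo] --> f^\- x.
  have /fine_cvgP[_] := cvg_nnsfun_approx measurableT mn (fun y _ => f0mn y) (I : setT x).
  exact.
have p_le n x : 0 <= p n x <= f^\+ x.
  rewrite fun_ge0/= -lee_fin /p nnsfun_approxE.
  by apply: (@le_approx _ _ _ setT (EFin \o f^\+)) => // y _; rewrite lee_fin.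
have m_le n x : 0 <= m n x <= f^\- x.
  rewrite fun_ge0/= -lee_fin /m nnsfun_approxE.
  by apply: (@le_approx _ _ _ setT (EFin \o f^\-)) => // y _; rewrite lee_fin.
exists (fun n x => p n x - m n x); split.
- by move=> n; apply: measurable_funB.
- move=> n; apply: (sub_finite_set _ (finite_image2 (fun u v => u - v)
    (fimfunP (p n)) (fimfunP (m n)))).
  by move=> _ [x _ <-]; exists (p n x); [exists x|exists (m n x); [exists x|]].
- move=> n x; have /andP[p0 pf] := p_le n x; have /andP[m0 mf0] := m_le n x.
  have fE : f x = f^\+ x - f^\- x by rewrite -[in LHS](funrposBneg f).
  have fN : `|f x| = f^\+ x + f^\- x by rewrite -[RHS]/((f^\+ + f^\-) x) funrposDneg.
  by rewrite fN {1}fE ler_norml; apply/andP; split; lra.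
- move=> x; rewrite [f x](_ : _ = f^\+ x - f^\- x); last by rewrite -[in LHS](funrposBneg f).
  by apply: cvgB.
Qed.

Lemma real_radon_nikodym (mu : {finite_measure set T -> \bar R}) (nu : set T -> R) :
  (forall A : (set T)^nat, (forall n, measurable (A n)) -> trivIset setT A ->
    series (nu \o A) @ \oo --> nu (\bigcup_n A n)) ->
  (forall A, measurable A -> mu A = 0%E -> nu A = 0) ->
  exists g : T -> R, mu.-integrable setT (EFin \o g) /\
    forall A, measurable A -> (nu A)%:E = (\int[mu]_(x in A) (g x)%:E)%E.
Proof.
move=> nu_add nu_ac.
pose nuE (A : set T) := (nu A)%:E.
have nu0 : nuE set0 = 0%E by rewrite /nuE nu_ac// measure0.
have nu_fin A : measurable A -> nuE A \is a fin_num by [].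
have nu_sigma : semi_sigma_additive nuE.
  move=> F mF tF _; apply/fine_cvgP; split; first by apply: nearW => n; rewrite sumEFin.
  apply: cvg_trans (nu_add F mF tF).
  by apply: near_eq_cvg; apply: nearW => n; rewrite /= /series/= sumEFin.
pose nuC : {charge set T -> \bar R} :=
  HB.pack nuE (isCharge.Build _ _ _ nuE nu0 nu_fin nu_sigma).
have nu_mu : nuC `<< mu.
  by move=> N N0 A mA AN; rewrite /= /nuE nu_ac// N0.
exists (fun x => fine (Radon_Nikodym nuC mu x)).
have gE : EFin \o (fun x => fine (Radon_Nikodym nuC mu x)) = Radon_Nikodym nuC mu.
  by apply/funext => x /=; rewrite fineK// Radon_Nikodym_fin_num.
split; first by rewrite gE; exact: Radon_Nikodym_integrable.
move=> A mA; rewrite -[LHS]/(nuC A) (Radon_Nikodym_integral nu_mu mA).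
by apply: eq_integral => x _; rewrite -gE.
Qed.

End scalar_tools.

(** * Densities of the coordinates of an l1-valued measure *)

Section ell1_densities.
Context d (T : measurableType d) (R : realType).
Variable mu : {finite_measure set T -> \bar R}.
Variable G : set T -> ell1 R.
Hypotheses (Gvm : vector_measure G) (Gac : vanishes_on_null_sets mu G).
Variable M : R.
Hypothesis GM : forall (n : nat) (A : (set T)^nat),
  (forall i, measurable (A i)) -> trivIset setT A -> \sum_(i < n) `|G (A i)| <= M.

Lemma coordinate_density i : exists g : T -> R, mu.-integrable setT (EFin \o g) /\
  forall A, measurable A -> (Lspace1_fun (G A) i)%:E = (\int[mu]_(x in A) (g x)%:E)%E.
Proof.
apply: (@real_radon_nikodym _ _ _ _ (fun A => Lspace1_fun (G A) i)).
- move=> A mA tA; have coord_cont : continuous (ell1_coord i : {linear ell1 R -> R^o}).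
    by apply: (@continuous_of_bound _ _ _ _ 1) => u; rewrite mul1r; exact: ell1_coord_le.
  have coord_cvg : Lspace1_fun (series (G \o A) n) i @[n --> \oo] -->
      Lspace1_fun (G (\bigcup_n A n)) i.
    exact: continuous_cvg _ (coord_cont (G (\bigcup_n A n))) (Gvm mA tA).
  apply: cvg_trans coord_cvg; apply: near_eq_cvg; apply: nearW => n.
  rewrite /= /series/= -[LHS]/(ell1_coord i _).
  by rewrite (raddf_sum (ell1_coord i : {linear ell1 R -> R^o})).
- move=> A mA A0; rewrite Gac//.
  exact: (linear0 (ell1_coord i : {linear ell1 R -> R^o})).
Qed.

Section total_variation.
Variable g : nat -> T -> R.
Hypothesis ig : forall i, mu.-integrable setT (EFin \o g i).
Hypothesis gG : forall i A, measurable A ->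
  (Lspace1_fun (G A) i)%:E = (\int[mu]_(x in A) (g i x)%:E)%E.
Variable N : nat.

(* The cells on which the signs of [g 0], ..., [g (N - 1)] are constant, numbered
   through an enumeration of the sign vectors. *)
Let signs x : {ffun 'I_N -> bool} := [ffun i : 'I_N => 0 <= g i x].

Let cell (k : nat) : set T := [set x | enum_rank (signs x) = k :> nat].

Let measurable_g i : measurable_fun setT (g i).
Proof. by apply/measurable_EFinP; exact: measurable_int (ig i). Qed.

Let cell_measurable k : measurable (cell k).
Proof.
have -> : cell k = \bigcup_(s in [set s : {ffun 'I_N -> bool} | enum_rank s = k :> nat])
    \bigcap_(i in [set: 'I_N]) [set x | (0 <= g i x) = s i].
  apply/seteqP; split=> [x kx|x [s /= sk sx]].
    by exists (signs x) => // i _ /=; rewrite ffunE.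
  by rewrite /cell/= -sk; do 2 congr (_ _); apply/ffunP => i; rewrite ffunE sx.
apply: fin_bigcup_measurable => [|s _]; first exact: finite_finset.
apply: fin_bigcap_measurable => [|i _]; first exact: finite_finset.
have mb : measurable_fun setT (fun x => 0 <= g i x) by exact: measurable_fun_ler.
by rewrite -[X in measurable X]setTI; apply: (mb measurableT [set s i]).
Qed.

Let cell_trivIset : trivIset setT cell.
Proof. by move=> k l _ _ [x []] /= <- <-. Qed.

(* On a cell [g i] has a constant sign, so the integral of [|g i|] is, up to sign,
   that of [g i]. *)
Let integral_cell_le (j : 'I_#|{ffun 'I_N -> bool}|) (i : 'I_N) :
  (\int[mu]_(x in cell j) `|g i x|%:E <= `|Lspace1_fun (G (cell j)) i|%:E)%E.
Proof.
have sign_cell x : x \in cell j -> (0 <= g i x) = enum_val j i.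
  rewrite inE /cell/= => /val_inj <-; rewrite enum_rankK /signs ffunE//.
case: (enum_val j i) sign_cell => sign_cell.
  rewrite (eq_integral (fun x => (g i x)%:E)); last by move=> x /sign_cell gx; rewrite ger0_norm.
  by rewrite -gG// lee_fin ler_norm.
rewrite (eq_integral (fun x => - (g i x)%:E)%E); last first.
  by move=> x /sign_cell gx; rewrite ltr0_norm// ltNge gx.
rewrite integralN; last first.
  apply: integrable_add_def; first exact: cell_measurable.
  exact: integrableS measurableT (cell_measurable j) (@subsetT _ _) (ig i).
by rewrite -gG// -EFinN lee_fin -normrN ler_norm.
Qed.

(** Summing over the cells first gives the norms in l1 of the values of [G] on the
    cells, which are disjoint. *)
Lemma partial_variation_le : (\sum_(i < N) \int[mu]_x `|g i x|%:E <= M%:E)%E.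
Proof.
have splitE (i : 'I_N) : (\int[mu]_x `|g i x|%:E =
    \sum_(j < #|{ffun 'I_N -> bool}|) \int[mu]_(x in cell j) `|g i x|%:E)%E.
  transitivity (\int[mu]_x \sum_(j < #|{ffun 'I_N -> bool}|)
      (((fun x => `|g i x|%:E) \_ (cell j)) x))%E.
    apply: eq_integral => x _; rewrite (bigD1 (enum_rank (signs x)))//= patchE mem_set//.
    rewrite big1 ?adde0// => j jx; rewrite patchE memNset// => xj.
    by move/eqP: jx; apply; apply: val_inj.
  rewrite ge0_integral_sum//.
  - by apply: eq_bigr => j _; rewrite -integral_mkcond.
  - move=> j; apply/(measurable_restrictT _ _).1 => //.
    by apply/measurable_EFinP; apply: measurable_funTS; apply: measurableT_comp.
  - by move=> j x _; rewrite erestrict_ge0// => y _; rewrite lee_fin.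
under eq_bigr do rewrite splitE.
rewrite exchange_big/=.
apply: (@le_trans _ _ (\sum_(j < #|{ffun 'I_N -> bool}|) `|G (cell j)|%:E)%E).
  apply: lee_sum => j _.
  apply: le_trans (_ : ((\sum_(i < N) `|Lspace1_fun (G (cell j)) i|)%:E <= _)%E).
    by rewrite -sumEFin; apply: lee_sum => i _; exact: integral_cell_le.
  by rewrite lee_fin ell1_partial_sum_le.
by rewrite sumEFin lee_fin GM.
Qed.
End total_variation.

(** By monotone convergence the sum of the [|g i|] is integrable, hence finite off
    a null set, on which the densities are replaced by 0. *)
Lemma ell1_density : exists g : nat -> T -> R,
  [/\ forall i, measurable_fun setT (g i),
      forall x, (\sum_(i <oo) `|g i x|%:E < +oo)%E,
      (\int[mu]_x \sum_(i <oo) `|g i x|%:E < +oo)%E &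
      forall i A, measurable A ->
        (Lspace1_fun (G A) i)%:E = (\int[mu]_(x in A) (g i x)%:E)%E].
Proof.
have /choice[f /all_and2[fi fG]] := coordinate_density.
have mf i : measurable_fun setT (f i) by apply/measurable_EFinP; exact: measurable_int (fi i).
have mnf i : measurable_fun setT (fun x => `|f i x|%:E).
  by apply/measurable_EFinP; exact: measurableT_comp.
pose H x : \bar R := (\sum_(i <oo) `|f i x|%:E)%E.
have mH : measurable_fun setT H.
  by apply: ge0_emeasurable_sum => // i x _ _; rewrite lee_fin.
have H0 x : (0 <= H x)%E by apply: nneseries_ge0 => i _ _; rewrite lee_fin.
have HM : (\int[mu]_x H x <= M%:E)%E.
  rewrite integral_nneseries//.
  apply: lime_le; first by apply: is_cvg_nneseries => i _ _; exact: integral_ge0.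
  by apply: nearW => n; rewrite big_mkord; exact: partial_variation_le.
have iH : mu.-integrable setT H.
  apply/integrableP; split=> //; under eq_integral do rewrite gee0_abs//.
  by rewrite (le_lt_trans HM)// ltry.
pose D := [set x | H x \is a fin_num].
have mD : measurable D by rewrite -[D]setTI; exact: emeasurable_fin_num.
have aeD : {ae mu, forall x, D x}.
  by move: (integrable_ae measurableT iH); apply: filterS => x; exact.
have mg i : measurable_fun setT (fun x => f i x * \1_D x).
  by apply: measurable_funM; [exact: mf|exact: measurable_indic].
exists (fun i x => f i x * \1_D x); split.
- exact: mg.
- move=> x; have [Dx|Dx] := pselect (D x).
    under eq_eseriesr do rewrite indicE mem_set// mulr1.
    by rewrite ltey_eq (_ : _ \is a fin_num).
  under eq_eseriesr do rewrite indicE memNset// mulr0 normr0.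
  by rewrite eseries0.
- apply: (@le_lt_trans _ _ (\int[mu]_x H x)%E); last by rewrite (le_lt_trans HM)// ltry.
  apply: ge0_le_integral => //.
  - by move=> x _; apply: nneseries_ge0 => i _ _; rewrite lee_fin.
  - apply: ge0_emeasurable_sum => [i x _ _|i _]; first by rewrite lee_fin.
    by apply/measurable_EFinP; apply: measurableT_comp => //; exact: mg.
  - move=> x _; apply: lee_nneseries => i _; rewrite lee_fin// normrM ler_piMr//.
    by rewrite indicE; case: (_ \in _); rewrite ?normr0 ?normr1.
move=> i A mA; rewrite fG//; apply: ae_eq_integral => //.
- by apply/measurable_EFinP; exact: measurable_funTS.
- by apply/measurable_EFinP; apply: measurable_funTS; exact: mg.
- by apply: filterS aeD => x Dx _; rewrite indicE mem_set// mulr1.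
Qed.
End ell1_densities.

(** * The Radon-Nikodym property of l1 *)

Section ell1_of_sequence.
Variable R : realType.

(** Total on sequences, so that finiteness of a range of l1-valued maps can be read
    off from the underlying sequences. *)
Definition ell1_of (a : nat -> R) : ell1 R :=
  match pselect ((@counting nat R).-integrable setT (EFin \o a)) with
  | left ia => Lspace1_class ia
  | right _ => 0
  end.

Lemma ell1_ofE (a : nat -> R) i : (\sum_(n <oo) `|a n|%:E < +oo)%E ->
  Lspace1_fun (ell1_of a) i = a i.
Proof.
move=> /ell1_of_seqP ia; rewrite /ell1_of; case: pselect => // ia'.
exact: ell1_classE.
Qed.

Lemma ell1_dist (u v : ell1 R) :
  (`|u - v|%:E = \sum_(i <oo) `|Lspace1_fun u i - Lspace1_fun v i|%:E)%E.
Proof.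
rewrite ell1_norm; apply: eq_eseriesr => i _.
by rewrite -[Lspace1_fun (u - v) i]/(ell1_coord i (u - v)) linearB.
Qed.

Lemma finite_set_finite_sequences (V : nat -> set R) (n : nat) :
  (forall i, finite_set (V i)) ->
  finite_set [set a : nat -> R | forall i, if (i < n)%N then V i (a i) else a i = 0].
Proof.
move=> finV; elim: n => [|n IH].
  apply: (@sub_finite_set _ _ [set fun=> 0]) => // a a0.
  by apply/funext => i; exact: a0 i.
apply: (sub_finite_set _ (finite_image2 (fun a v i => if i == n then v else a i) IH (finV n))).
move=> a aV; exists (fun i => if i == n then 0 else a i); last exists (a n).
- move=> i /=; have := aV i; rewrite ltnS leq_eqVlt.
  by have [->|] := eqVneq i n; rewrite ?ltnn//=.
- by have := aV n; rewrite ltnSn.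
- by apply/funext => i; case: eqVneq => [->|].
Qed.

End ell1_of_sequence.

Section integral_of_simple_function.
Context d (T : measurableType d) (R : realType) (X : normedModType R).
Variable mu : {finite_measure set T -> \bar R}.

Lemma integral_comp_simple (phi : X -> R) (s : T -> X) (A : set T) : measurable A ->
  simple_function s ->
  \int[mu]_(x in A) phi (s x) =
  \sum_(v \in range s) fine (mu (A `&` s @^-1` [set v])) * phi v.
Proof.
move=> mA [sfin smeas].
have phis x : (phi (s x))%:E = (\sum_(v <- enum_fset (fset_set (range s))) (phi v)%:E * (\1_(s @^-1` [set v]) x)%:E)%E.
  have sx : s x \in fset_set (range s) by rewrite in_fset_set// inE; exists x.
  rewrite (bigD1_seq (s x))//= ?fset_uniq// big1 ?adde0 => [|v /eqP vx].
    by rewrite indicE mem_set// mule1.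
  by rewrite indicE memNset ?mule0// => /esym.
rewrite /Rintegral; under eq_integral do rewrite phis.
rewrite fsbig_finite//= integral_sum//; last first.
  move=> v; apply: integrableZl => //; apply: (integrableS measurableT mA) => //.
  exact: integrable_indic.
rewrite (eq_bigr (fun v => (fine (mu (A `&` s @^-1` [set v])) * phi v)%:E)); first by rewrite sumEFin.
move=> v _; rewrite integralZl//; last first.
  by apply: (integrableS measurableT mA) => //; exact: integrable_indic.
rewrite integral_indic// [X in mu X]setIC mulrC EFinM fineK// fin_num_measure//.
exact: measurableI.
Qed.

End integral_of_simple_function.

Section ell1_radon_nikodym.
Context d (T : measurableType d) (R : realType).
Variable mu : {finite_measure set T -> \bar R}.
Variable G : set T -> ell1 R.
Variable g : nat -> T -> R.
Hypothesis mg : forall i, measurable_fun setT (g i).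
Hypothesis g_lty : forall x, (\sum_(i <oo) `|g i x|%:E < +oo)%E.
Hypothesis ig : (\int[mu]_x \sum_(i <oo) `|g i x|%:E < +oo)%E.
Hypothesis gG : forall i A, measurable A ->
  (Lspace1_fun (G A) i)%:E = (\int[mu]_(x in A) (g i x)%:E)%E.

Variable q : nat -> nat -> T -> R.
Hypothesis mq : forall i n, measurable_fun setT (q i n).
Hypothesis q_fin : forall i n, finite_set (range (q i n)).
Hypothesis q_le : forall i n x, `|g i x - q i n x| <= `|g i x|.
Hypothesis q_cvg : forall i x, q i n x @[n --> \oo] --> g i x.

(* The [n]-th approximant keeps [n] coordinates, each replaced by its [n]-th simple
   approximation. *)
Let t n x i : R := if (i < n)%N then q i n x else 0.

Let mt n i : measurable_fun setT (fun x => t n x i).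
Proof. by rewrite /t; case: (i < n)%N; [exact: mq|exact: measurable_cst]. Qed.

Let t_le n x i : `|g i x - t n x i| <= `|g i x|.
Proof. by rewrite /t; case: ifP => _; rewrite ?subr0 ?lexx ?q_le. Qed.

Let t_cvg x i : t n x i @[n --> \oo] --> g i x.
Proof.
apply: cvg_trans (@q_cvg i x); apply: near_eq_cvg; near=> n.
by rewrite /t; case: ifPn => // /negP[]; near: n; exact: nbhs_infty_gt.
Unshelve. all: by end_near. Qed.

Let t_lty n x : (\sum_(i <oo) `|t n x i|%:E < +oo)%E.
Proof.
have : (2%:E * \sum_(i <oo) `|g i x|%:E < +oo)%E by rewrite lte_mul_pinfty.
apply: le_lt_trans; rewrite -nneseriesZl//; apply: lee_nneseries => // i _.
rewrite -EFinM lee_fin; have := t_le n x i.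
by have := ler_normB (g i x) (g i x - t n x i); rewrite subKr; lra.
Qed.

Let density x : ell1 R := ell1_of (g ^~ x).

Let approximant n x : ell1 R := ell1_of (t n x).

Let densityE x i : Lspace1_fun (density x) i = g i x.
Proof. exact: ell1_ofE. Qed.

Let approximantE n x i : Lspace1_fun (approximant n x) i = t n x i.
Proof. exact: ell1_ofE. Qed.

Let distE n x : (`|density x - approximant n x|%:E = \sum_(i <oo) `|g i x - t n x i|%:E)%E.
Proof. by rewrite ell1_dist; apply: eq_eseriesr => i _; rewrite densityE approximantE. Qed.

Let approximant_simple n : simple_function (approximant n).
Proof.
split.
  have -> : range (approximant n) = @ell1_of R @` range (t n) by rewrite image_comp.
  apply: finite_image; apply: sub_finite_set (finite_set_finite_sequences n (q_fin ^~ n)).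
  move=> _ [x _ <-] i; rewrite /t; case: (i < n)%N => //.
move=> u; have -> : approximant n @^-1` [set u] =
    \bigcap_i ((fun x => t n x i) @^-1` [set Lspace1_fun u i]).
  apply/seteqP; split=> [x /= <- i _ /=|x /= tu]; first by rewrite approximantE.
  by apply: ell1_ext => i; rewrite approximantE; exact: tu.
apply: bigcapT_measurable => i.
by rewrite -[X in measurable X]setTI; exact: mt.
Qed.

(* Dominated convergence for the counting measure, with bound [|g i x|]. *)
Let dist_cvg x : (\sum_(i <oo) `|g i x - t n x i|%:E)%E @[n --> \oo] --> 0%E.
Proof.
have [|||||_ + _] := @dominated_convergence _ _ _ (@counting nat R) setT measurableT
  (fun n i => `|g i x - t n x i|%:E) (cst 0%E) (fun i => `|g i x|%:E).
- by [].
- by [].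
- apply: aeW => i _; rewrite (_ : cst 0%E i = (`|g i x - g i x|)%:E)%E; last first.
    by rewrite subrr normr0.
  apply: cvg_EFin; first exact: nearW.
  by apply: cvg_norm; apply: cvgB; [exact: cvg_cst|exact: t_cvg].
- apply: (ell1_of_seqP (a := fun i => `|g i x|)).
  by under eq_eseriesr do rewrite normr_id.
- by apply: aeW => i n _; rewrite lee_fin normr_id.
apply: cvg_trans; apply: near_eq_cvg; apply: nearW => n /=.
rewrite -ge0_integral_count//; apply: eq_integral => i _.
by rewrite subr0 normr_id.
Qed.

Let m_dist n : measurable_fun setT (fun x => \sum_(i <oo) `|g i x - t n x i|%:E)%E.
Proof.
apply: ge0_emeasurable_sum => [i x _ _|i _]; first by rewrite lee_fin.
by apply/measurable_EFinP; apply: measurableT_comp => //; exact: measurable_funB.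
Qed.

Let total_integrable : mu.-integrable setT (fun x => \sum_(i <oo) `|g i x|%:E)%E.
Proof.
apply/integrableP; split.
  apply: ge0_emeasurable_sum => [i x _ _|i _]; first by rewrite lee_fin.
  by apply/measurable_EFinP; exact: measurableT_comp.
by under eq_integral do rewrite gee0_abs ?nneseries_ge0//.
Qed.

(* Dominated convergence for [mu], with bound the norm of the density. *)
Let integral_dist_cvg :
  (\int[mu]_x \sum_(i <oo) `|g i x - t n x i|%:E)%E @[n --> \oo] --> 0%E.
Proof.
have [|||||_ + _] := @dominated_convergence _ _ _ mu setT measurableT
  (fun n x => \sum_(i <oo) `|g i x - t n x i|%:E)%E (cst 0%E)
  (fun x => \sum_(i <oo) `|g i x|%:E)%E.
- by [].
- by [].
- by apply: aeW => x _; exact: dist_cvg.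
- exact: total_integrable.
- apply: aeW => x n _; rewrite gee0_abs ?nneseries_ge0//.
  by apply: lee_nneseries => // i _; rewrite lee_fin.
apply: cvg_trans; apply: near_eq_cvg; apply: nearW => n /=.
by apply: eq_integral => x _; rewrite sube0 gee0_abs// nneseries_ge0.
Qed.

Let simple_integral_coord A n i : measurable A ->
  Lspace1_fun (simple_integral mu A (approximant n)) i = \int[mu]_(x in A) t n x i.
Proof.
move=> mA; have [sfin _] := approximant_simple n.
rewrite -[LHS]/(ell1_coord i _) /simple_integral fsbig_finite//= linear_sum.
transitivity (\int[mu]_(x in A) ell1_coord i (approximant n x)); last first.
  by apply: eq_Rintegral => x _; exact: approximantE.
rewrite integral_comp_simple// fsbig_finite//=.
by apply: eq_bigr => u _; rewrite linearZ.
Qed.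

(* Coordinate by coordinate, both sides are integrals of [t n _ i] and [g i], so
   the distance is at most the L1 distance of the approximant to the density. *)
Let simple_integral_dist_le A n : measurable A ->
  (`|simple_integral mu A (approximant n) - G A|%:E <=
   \int[mu]_x \sum_(i <oo) `|g i x - t n x i|%:E)%E.
Proof.
move=> mA; have mgt i : measurable_fun setT (fun x => g i x - t n x i).
  exact: measurable_funB.
have igi i : mu.-integrable A (EFin \o g i).
  apply: (integrableS measurableT mA) => //.
  apply: le_integrable total_integrable => //; first exact/measurable_EFinP.
  move=> x _; rewrite [leRHS]gee0_abs ?nneseries_ge0//.
  rewrite (le_trans _ (nneseries_lim_ge (u_ := fun i => `|g i x|%:E) (P := xpredT) (m := 0%N) i.+1 _))//.
  rewrite big_nat_recr//= leeDr//.
  by apply: sume_ge0 => j _; rewrite lee_fin.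
have it i : mu.-integrable A (EFin \o (fun x => t n x i)).
  have : mu.-integrable A (fun x => 2%:E * (EFin \o g i) x)%E by exact: integrableZl.
  apply: le_integrable => //; first by apply/measurable_EFinP; exact: measurable_funTS.
  move=> x _; rewrite -EFinM lee_fin [leRHS]normrM (ger0_norm (ler0n R 2)).
  have := t_le n x i; have := ler_normB (g i x) (g i x - t n x i).
  by rewrite subKr; lra.
rewrite integral_nneseries//; last by move=> i; apply/measurable_EFinP; exact: measurableT_comp.
rewrite ell1_dist; apply: lee_nneseries => // i _.
rewrite simple_integral_coord// distrC -[Lspace1_fun (G A) i]/(fine (Lspace1_fun (G A) i)%:E).
rewrite gG// -RintegralB// EFin_normr_Rintegral//; last exact: (integrableB mA (igi i) (it i)).
apply: le_trans (le_abse_integral _ _ _) _ => //.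
  by apply/measurable_EFinP; exact: measurable_funTS.
apply: ge0_subset_integral => //.
by apply/measurable_EFinP; exact: measurableT_comp.
Qed.

Lemma ell1_bochner_density A : measurable A -> has_bochner_integral mu A density (G A).
Proof.
move=> mA; exists approximant; first split.
- exact: approximant_simple.
- apply: aeW => x; apply/cvgrPdist_lt => e e0.
  have /fine_cvgP[fin /cvgrPdist_lt/(_ _ e0)] := dist_cvg x.
  apply: filterS => n; rewrite sub0r normrN /= -distE /= ger0_norm//.
- by under eq_fun do under eq_integral do rewrite distE.
apply/cvgrPdist_lt => e e0.
have /fine_cvgP[fin /cvgrPdist_lt/(_ _ e0)] := integral_dist_cvg.
apply: filterS2 fin => n nfin; rewrite sub0r normrN ger0_norm ?fine_ge0 ?integral_ge0//; last first.
  by move=> x _; exact: nneseries_ge0.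
rewrite distrC; apply: le_lt_trans; rewrite -lee_fin [leRHS]fineK//.
exact: simple_integral_dist_le.
Qed.

End ell1_radon_nikodym.

Lemma ell1_radon_nikodym_property (R : realType) : radon_nikodym_property (ell1 R).
Proof.
move=> d T mu G Gvm [M GM] Gac.
have [g [mg g_lty ig gG]] := ell1_density Gvm Gac GM.
have /choice[q qP] i := simple_approximation (mg i).
exists (fun x => ell1_of (g ^~ x)) => A mA.
apply: (@ell1_bochner_density _ _ _ mu G g mg g_lty ig gG q) => //.
- by move=> i; have [] := qP i.
- by move=> i; have [] := qP i.
- by move=> i; have [] := qP i.
- by move=> i; have [] := qP i.
Qed.

(** * The subspace of L1[0,1] *)

Theorem corollary6p11 (R : realType) :
  exists E : closed_subspace (L1_unit_interval R),
    [/\ isomorphic (subspace_type E) (ell1 R),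
        radon_nikodym_property (subspace_type E) &
        ~ daugavet_property (quotient_space E)].
Proof.
have [E [E_ell1 E_quotient]] := L1_unit_interval_quotient_not_daugavet R.
exists E; split=> //; apply: radon_nikodym_isomorphic E_ell1 _.
exact: ell1_radon_nikodym_property.
Qed.
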